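(* Let $n_1,m_1,n_2,m_2$ denote positive integers with $(n_1,m_1)\neq(n_2,m_2)$, let $G_1=K_{n_1,m_1}$ and $G_2=K_{n_2,m_2}$ be complete bipartite graphs, let $u_1$ be a vertex of the part of size $n_1$ of $G_1$ and $u_2$ a vertex of the part of size $n_2$ of $G_2$, and let $\varepsilon\in(0,1)$ be the noise. Then: 1. if $n_1=n_2=1$, then $(G_1,u_1)$ and $(G_2,u_2)$ are not NVM-distinguishable; 2. if $n_1=n_2>1$ or $m_1=m_2$, then $(G_1,u_1)$ and $(G_2,u_2)$ are distinguishable by $S^{(2)}$; 3. if $(1-\varepsilon)^2$ is not a root of a polynomial of degree $3$ with integer coefficients, and $\max\{n_1,n_2\}>1$, then $(G_1,u_1)$ and $(G_2,u_2)$ are distinguishable by $S^{(2)}$; 4. for every $k$ and every $\varepsilon'\in(0,1)$, there exist $\varepsilon\in(0,\varepsilon')$, distinct $n_1,n_2>k$ and distinct $m_1,m_2>k$ such that, for the noise $\varepsilon$, $(G_1,u_1)$ and $(G_2,u_2)$ are NVM-distinguishable but $p_d(G_1,u_1)=p_d(G_2,u_2)$ for any $d\in\mathbb N$.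
   Context: Noisy voter model (NVM) with noise $\varepsilon\in(0,1)$ on a connected (locally finite, with at least two vertices) graph $G$: let $N_G(u)$ be the set of neighbors of $u$. At time $0$, $X_0(u)\sim\mathrm{Bern}(1/2)$ independently over all $u\in V(G)$. For every $t\ge 1$ and $u\in V(G)$, $$X_t(u)=\xi_t(u)Y_t(u)+(1-\xi_t(u))\sum_{v\in N_G(u)}I(\eta_t(u)=v)X_{t-1}(v),$$ where $\xi_t(u)\sim\mathrm{Bern}(\varepsilon)$, $Y_t(u)\sim\mathrm{Bern}(1/2)$, $\eta_t(u)$ is uniform on $N_G(u)$, and all the variables $\xi_t(u),Y_t(u),\eta_t(u)$ ($t\ge1$, $u\in V(G)$) and $X_0(u)$ ($u\in V(G)$) are independent. Write $X_t(G,u)=X_t(u)$. Distinguishability: let $(G_1,u_1),(G_2,u_2)$ be rooted graphs, both running the NVM with the same $\varepsilon$. They are distinguishable by a sequence $S=(S_t)_{t}$, where $S_t$ is a real-valued function of the observations up to time $t$ at a vertex, if there are sets $\mathcal S_1(t),\mathcal S_2(t)\subset\mathbb R$, disjoint for each $t$, such that $$\mathsf P\big[S_t(X_i(G_1,u_1),\,i\le t)\in\mathcal S_1(t),\ S_t(X_i(G_2,u_2),\,i\le t)\in\mathcal S_2(t)\big]\to1\quad (t\to\infty).$$ They are NVM-distinguishable if they are distinguishable by some such sequence $S$. Repetition statistic: for $d\in\mathbb N$ and $t>d$, $S^{(d)}_t=\frac1{t-d}\sum_{i=1}^{t-d}I(X_i(u)=X_{i+d}(u))$, where $u$ is the observed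 vertex, and $S^{(d)}=(S^{(d)}_t)_t$. The quantity $p_d(G,u)$: let $\mathcal D_G$ be the random directed graph on $V(G)\times\mathbb Z_+$ whose edges are exactly $((w,t),(v,t-1))$ with $t\ge1$, $\xi_t(w)=0$, $\eta_t(w)=v$. Let $\pi_t$ be the longest directed path in $\mathcal D_G$ starting at $(u,t)$; let $p_{t;d}$ be the probability that $\pi_t$ and $\pi_{t+d}$ have a common vertex. It is non-decreasing in $t$, and $p_d(G,u)=\lim_{t\to\infty}p_{t;d}$. *)

(* Defs.v *)
From HB Require Import structures.
From mathcomp Require Import all_boot all_order all_algebra finmap.
From mathcomp Require Import all_classical all_reals all_analysis.

Set Implicit Arguments.
Unset Strict Implicit.
Unset Printing Implicit Defensive.

Import Order.TTheory GRing.Theory Num.Theory.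

Local Open Scope classical_set_scope.
Local Open Scope ring_scope.

(* Locally finite simple graphs. [nbr u] is N_G(u). *)
Record graph := Graph {
  vertex :> choiceType;
  nbr : vertex -> {fset vertex};
  nbr_sym : forall u v, (v \in nbr u) = (u \in nbr v);
  nbr_irr : forall u, u \notin nbr u }.

Definition connected (G : graph) : Prop :=
  forall u v : G,
    exists p : seq G, path (fun x y => y \in nbr x) u p /\ last u p = v.

Definition bip_adj (n m : nat) : rel ('I_n + 'I_m) := fun u v =>
  match u, v with
  | inl _, inr _ | inr _, inl _ => true
  | _, _ => false
  end.

Definition bip_nbr (n m : nat) (u : 'I_n + 'I_m) : {fset 'I_n + 'I_m} :=
  [fset v in bip_adj u]%fset.

Lemma in_bip_nbr (n m : nat) (u v : 'I_n + 'I_m) :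
  (v \in bip_nbr u) = bip_adj u v.
Proof. by rewrite in_fset. Qed.

Lemma bip_nbr_sym (n m : nat) (u v : 'I_n + 'I_m) :
  (v \in bip_nbr u) = (u \in bip_nbr v).
Proof. by rewrite !in_bip_nbr; case: u v => [i|i] [j|j]. Qed.

Lemma bip_nbr_irr (n m : nat) (u : 'I_n + 'I_m) : u \notin bip_nbr u.
Proof. by rewrite in_bip_nbr; case: u. Qed.

(* K_{n,m}; the part of size n consists of the vertices [inl i]. *)
Definition complete_bipartite (n m : nat) : graph :=
  Graph (@bip_nbr_sym n m) (@bip_nbr_irr n m).

Lemma complete_bipartite_connected (n m : nat) :
  (0 < n)%N -> (0 < m)%N -> connected (complete_bipartite n m).
Proof.
move=> n0 m0; pose a := Ordinal n0; pose b := Ordinal m0 => -[i|i] [j|j].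
- by exists [:: inr b; inl j] => /=; rewrite !in_bip_nbr.
- by exists [:: inr j] => /=; rewrite !in_bip_nbr.
- by exists [:: inl j] => /=; rewrite !in_bip_nbr.
- by exists [:: inl a; inr j] => /=; rewrite !in_bip_nbr.
Qed.

(* Mutual independence of a family of classes of events; random variables are
   independent when the classes of the events they generate are. *)
Definition independent_classes (R : realType) (dsp : measure_display)
    (Omega : measurableType dsp) (P : probability Omega R)
    (I : choiceType) (E : I -> set (set Omega)) : Prop :=
  forall (J : {fset I}) (A : I -> set Omega),
    (forall i, i \in J -> E i (A i)) ->
    P (\bigcap_(i in [set` J]) A i) = (\prod_(i <- J) P (A i))%E.

Definition generated_events (Omega T : Type) (Z : Omega -> T) :
  set (set Omega) := [set Z @^-1` B | B in [set: set T]].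

(* Indices of the random variables driving the model: [src_xi t u] stands for
   xi_{t+1}(u), and likewise for Y and eta, so that only times >= 1 occur. *)
Inductive source (V : Type) : Type :=
  | src_X0 of V
  | src_xi of nat & V
  | src_Y of nat & V
  | src_eta of nat & V.

HB.instance Definition _ (V : Type) := gen_eqMixin (source V).
HB.instance Definition _ (V : Type) := gen_choiceMixin (source V).

(* A realization, on the probability space (Omega, P), of the random variables
   driving the noisy voter model on G with noise eps. The values at t = 0 of
   [xi], [Y] and [eta] are never used. *)
Record nvm (R : realType) (dsp : measure_display)
    (Omega : measurableType dsp) (P : probability Omega R)
    (G : graph) (eps : R) := NVM {
  X0 : G -> {RV P >-> bool};
  xi : nat -> G -> {RV P >-> bool};
  Y : nat -> G -> {RV P >-> bool};
  eta : nat -> G -> Omega -> G;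
  X0_bern : forall u, distribution P (X0 u) =1 bernoulli_prob 2^-1;
  xi_bern : forall t u, (0 < t)%N ->
    distribution P (xi t u) =1 bernoulli_prob eps;
  Y_bern : forall t u, (0 < t)%N ->
    distribution P (Y t u) =1 bernoulli_prob 2^-1;
  eta_meas : forall t u (B : set G), (0 < t)%N ->
    measurable (eta t u @^-1` B);
  eta_unif : forall t u v, (0 < t)%N ->
    P (eta t u @^-1` [set v])
      = (if v \in nbr u then (#|` nbr u|%:R)^-1 else 0)%:E;
  nvm_indep : independent_classes P (fun s : source G =>
    match s with
    | src_X0 u => generated_events (X0 u)
    | src_xi t u => generated_events (xi t.+1 u)
    | src_Y t u => generated_events (Y t.+1 u)
    | src_eta t u => generated_events (eta t.+1 u)
    end) }.

Fixpoint nvm_state (R : realType) (dsp : measure_display)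
    (Omega : measurableType dsp) (P : probability Omega R)
    (G : graph) (eps : R) (N : nvm P G eps)
    (t : nat) (u : G) (w : Omega) : nat :=
  match t with
  | 0 => X0 N u w
  | t'.+1 =>
      (xi N t u w * Y N t u w
       + (1 - xi N t u w)
         * \sum_(v <- nbr u) (eta N t u w == v) * nvm_state N t' v w)%N
  end.

Definition observations (R : realType) (dsp : measure_display)
    (Omega : measurableType dsp) (P : probability Omega R)
    (G : graph) (eps : R) (N : nvm P G eps)
    (u : G) (t : nat) (w : Omega) : t.+1.-tuple nat :=
  [tuple nvm_state N i u w | i < t.+1].

Definition statistic (R : realType) : Type :=
  forall t : nat, t.+1.-tuple nat -> R.

Definition distinguishable_by (R : realType) (dsp : measure_display)
    (Omega : measurableType dsp) (P : probability Omega R) (eps : R)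
    (G1 : graph) (N1 : nvm P G1 eps) (u1 : G1)
    (G2 : graph) (N2 : nvm P G2 eps) (u2 : G2) (S : statistic R) : Prop :=
  exists S1 S2 : nat -> set R,
    (forall t, S1 t `&` S2 t = set0) /\
    P [set w | S1 t (S t (observations N1 u1 t w)) /\
               S2 t (S t (observations N2 u2 t w))] @[t --> \oo] --> 1%E.

Definition nvm_distinguishable (R : realType) (dsp : measure_display)
    (Omega : measurableType dsp) (P : probability Omega R) (eps : R)
    (G1 : graph) (N1 : nvm P G1 eps) (u1 : G1)
    (G2 : graph) (N2 : nvm P G2 eps) (u2 : G2) : Prop :=
  exists S : statistic R, distinguishable_by N1 u1 N2 u2 S.

(* For t <= d, where the statistic is not defined, the value is 0. *)
Definition repetition (R : realType) (d : nat) : statistic R := fun t x =>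
  ((t - d)%N%:R)^-1 *
  \sum_(1 <= i < (t - d).+1) (nth 0%N x i == nth 0%N x (i + d))%:R.

Definition dg_edge (R : realType) (dsp : measure_display)
    (Omega : measurableType dsp) (P : probability Omega R)
    (G : graph) (eps : R) (N : nvm P G eps) (w : Omega) : rel (G * nat) :=
  fun a b => [&& a.2 == b.2.+1, ~~ xi N a.2 a.1 w & eta N a.2 a.1 w == b.1].

Definition longest_dipath (R : realType) (dsp : measure_display)
    (Omega : measurableType dsp) (P : probability Omega R)
    (G : graph) (eps : R) (N : nvm P G eps) (w : Omega)
    (a : G * nat) (p : seq (G * nat)) : Prop :=
  path (dg_edge N w) a p /\
  forall q : seq (G * nat), path (dg_edge N w) a q -> (size q <= size p)%N.

(* The event that pi_t and pi_{t+d} have a common vertex. *)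
Definition paths_meet (R : realType) (dsp : measure_display)
    (Omega : measurableType dsp) (P : probability Omega R)
    (G : graph) (eps : R) (N : nvm P G eps) (u : G) (d t : nat) :
    set Omega :=
  [set w | exists p q : seq (G * nat),
     [/\ longest_dipath N w (u, t) p,
         longest_dipath N w (u, (t + d)%N) q
       & exists x, x \in (u, t) :: p /\ x \in (u, (t + d)%N) :: q]].

Definition p_ (R : realType) (dsp : measure_display)
    (Omega : measurableType dsp) (P : probability Omega R)
    (G : graph) (eps : R) (N : nvm P G eps) (u : G) (d : nat) : \bar R :=
  limn (fun t => P (paths_meet N u d t)).

(* Main.v *)
Require Import Defs.
From HB Require Import structures.
From mathcomp Require Import all_boot all_order all_algebra perm finmap.
From mathcomp Require Import all_classical all_reals all_analysis.
From mathcomp Require Import ring lra zify.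

(** Along K_{n,m} the configuration is a Markov chain driven by independent
    noises, and a noise with every [xi] equal to 1 forgets the past; hence the
    chain mixes geometrically and time averages of bounded windows of the
    observations concentrate around their stationary means. With spins in
    {-1,1}, x = (1-eps)^2 and A, B the mean spins of the two parts, one step
    sends A to (1-eps) B, A^2 to 1/n + (1-1/n) x B^2 and A^3 to a cubic in B,
    and symmetrically. So the limit of S^(2) is (1 + x p) / 2, where the
    stationary second moment p of A is
      (m + (n-1) x) / (nm - x^2 (n-1)(m-1)),
    and equality for two graphs is a cubic equation in x.

    If the values of p agree, the stationary means of s_0 s_2 s_4 s_6 and
    s_0 s_2 s_6 s_8 (s_i the spins observed at the root) are x (x p^2 + lV) and
    x (x p^2 + l^2 V), with l = x^2 (1-1/n) (1-1/m) and V > 0. Equality of both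
    would give equal l, and then p and l would determine n. Two coalescing walks
    meet with a probability obeying the recursion of the second moments, so
    p_d = x^(d/2) p for even d > 0 and p_d = 0 for odd d. A cubic with a root
    close to 1 is exhibited at (n,m) = (s+1, 2s), (2s+2, s).

    When n = 1 every leaf copies the centre, and the observations at the centre
    have a law that does not involve m. *)

Set Implicit Arguments.
Unset Strict Implicit.
Unset Printing Implicit Defensive.

Import Order.TTheory GRing.Theory Num.Theory.
Import numFieldNormedType.Exports.

Local Open Scope classical_set_scope.
Local Open Scope ring_scope.

(** * Expectations over independent noises *)

Section IteratedExpectation.
Variables (R : realType) (S : finType) (nu : S -> R).
Hypothesis nu_ge0 : forall s, 0 <= nu s.
Hypothesis nu_sum1 : \sum_s nu s = 1.

(** The mean of [F] over [k] independent letters of law [nu], drawn head first. Iterated sums make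
    conditioning on a prefix a matter of unfolding; [expect_seq_tuple] recovers the product law. *)
Fixpoint expect_seq (k : nat) (F : seq S -> R) : R :=
  if k is k'.+1 then \sum_s nu s * expect_seq k' (fun l => F (s :: l))
  else F [::].

Local Notation EN := expect_seq.

Lemma expect_seq_ext k F F' :
  (forall l, size l = k -> F l = F' l) -> EN k F = EN k F'.
Proof.
elim: k F F' => [|k IH] F F' FF' /=; first exact: FF'.
by apply: eq_bigr => s _; congr (_ * _); apply: IH => l sl; apply: FF'; rewrite /= sl.
Qed.

Lemma expect_seq_cst k c : EN k (fun=> c) = c.
Proof.
elim: k => //= k IH; under eq_bigr do rewrite IH.
by rewrite -mulr_suml nu_sum1 mul1r.
Qed.

Lemma expect_seqD k F F' : EN k (fun l => F l + F' l) = EN k F + EN k F'.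
Proof.
elim: k F F' => //= k IH F F'; rewrite -big_split /=.
by apply: eq_bigr => s _; rewrite IH mulrDr.
Qed.

Lemma expect_seqZ k c F : EN k (fun l => c * F l) = c * EN k F.
Proof.
elim: k F => //= k IH F; rewrite mulr_sumr.
by apply: eq_bigr => s _; rewrite IH mulrCA.
Qed.

Lemma expect_seq_sum k (I : Type) (r : seq I) (P : pred I) (F : I -> seq S -> R) :
  EN k (fun l => \sum_(i <- r | P i) F i l) = \sum_(i <- r | P i) EN k (F i).
Proof.
elim: r => [|i r IH].
  by under expect_seq_ext do rewrite big_nil; rewrite big_nil expect_seq_cst.
rewrite big_cons -IH; under expect_seq_ext do rewrite big_cons.
by case: (P i) => //; rewrite expect_seqD.
Qed.

Lemma expect_seq_le k F F' :
  (forall l, size l = k -> F l <= F' l) -> EN k F <= EN k F'.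
Proof.
elim: k F F' => [|k IH] F F' FF' /=; first exact: FF'.
by apply: ler_sum => s _; apply: ler_wpM2l => //; apply: IH => l sl; apply: FF'; rewrite /= sl.
Qed.

Lemma expect_seq_norm k F c :
  (forall l, size l = k -> `|F l| <= c) -> `|EN k F| <= c.
Proof.
move=> Fc; have h l : size l = k -> - c <= F l <= c by move=> /Fc; rewrite ler_norml.
rewrite ler_norml; apply/andP; split.
  by rewrite -(expect_seq_cst k (- c)); apply: expect_seq_le => l /h /andP[].
by rewrite -[leRHS](expect_seq_cst k c); apply: expect_seq_le => l /h /andP[].
Qed.

Lemma expect_seq_cat k1 k2 F :
  EN (k1 + k2) F = EN k1 (fun l1 => EN k2 (fun l2 => F (l1 ++ l2))).
Proof. by elim: k1 F => //= k1 IH F; apply: eq_bigr => s _; rewrite IH. Qed.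

(** Independent letters with a common law form an exchangeable list. The time reversal serves the
    walks, which read the noises from the latest to the earliest. *)
Lemma expect_seq_rev k F : EN k (fun l => F (rev l)) = EN k F.
Proof.
elim: k F => //= k IH F; rewrite -[RHS](_ : EN k.+1 F = _) // -addn1 expect_seq_cat /=.
rewrite expect_seq_sum; apply: eq_bigr => s _; rewrite expect_seqZ; congr (_ * _).
rewrite -(IH (fun l => F (l ++ [:: s]))).
by apply: expect_seq_ext => l _; rewrite rev_cons cats1.
Qed.

Lemma expect_seq_tuple k F :
  EN k F = \sum_(l : k.-tuple S) (\prod_(i < k) nu (tnth l i)) * F l.
Proof.
elim: k F => [|k IH] F /=.
  rewrite (big_pred1 [tuple]) => [|l]; first by rewrite big_ord0 mul1r.
  by rewrite [l]tuple0 /= eqxx.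
rewrite [RHS](reindex (fun sl : S * k.-tuple S => cons_tuple sl.1 sl.2)) /=; last first.
  exists (fun l : k.+1.-tuple S => (thead l, behead_tuple l)).
    by move=> [s l] _ /=; rewrite theadE; congr (_, _); apply: val_inj.
  by move=> l _ /=; rewrite [RHS]tuple_eta; apply: val_inj.
rewrite -(pair_bigA _ (fun s l => \prod_(i < k.+1) nu (tnth (cons_tuple s l) i) * F (s :: l))) /=.
apply: eq_bigr => s _; rewrite IH mulr_sumr; apply: eq_bigr => l _.
rewrite big_ord_recl tnth0 mulrA; congr (_ * _ * _).
by apply: eq_bigr => i _; rewrite tnthS.
Qed.

End IteratedExpectation.

(** * Markov chains driven by independent letters, and their geometric forgetting *)

Section RandomMap.
Variables (R : realType) (S : finType) (nu : S -> R).
Hypothesis nu_ge0 : forall s, 0 <= nu s.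
Hypothesis nu_sum1 : \sum_s nu s = 1.
Variables (Z : finType) (step : S -> Z -> Z).

Definition trans (f : Z -> R) (z : Z) : R := \sum_s nu s * f (step s z).

Definition run (z : Z) (l : seq S) : Z := foldl (fun z s => step s z) z l.

Local Notation EN := (expect_seq nu).
Local Notation K := trans.

Lemma run_cat z l1 l2 : run z (l1 ++ l2) = run (run z l1) l2.
Proof. exact: foldl_cat. Qed.

Lemma run_rcons z l s : run z (rcons l s) = step s (run z l).
Proof. by rewrite -cats1 run_cat. Qed.

Lemma expect_run k f z : EN k (fun l => f (run z l)) = iter k K f z.
Proof.
by elim: k z => //= k IH z; apply: eq_bigr => s _; rewrite -IH.
Qed.

Lemma transD f g : K (f \+ g) =1 K f \+ K g.
Proof. by move=> z; rewrite /trans /= -big_split; apply: eq_bigr => s _; rewrite mulrDr. Qed.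

Lemma transZ c f : K (fun z => c * f z) =1 (fun z => c * K f z).
Proof. by move=> z; rewrite /trans mulr_sumr; apply: eq_bigr => s _; rewrite mulrCA. Qed.

Lemma trans_cst c : K (fun=> c) =1 (fun=> c).
Proof. by move=> z; rewrite /trans -mulr_suml nu_sum1 mul1r. Qed.

Lemma trans_ext f g : f =1 g -> K f =1 K g.
Proof. by move=> fg z; apply: eq_bigr => s _; rewrite fg. Qed.

Lemma iter_transD k f g : iter k K (f \+ g) =1 iter k K f \+ iter k K g.
Proof. by elim: k => //= k IH z; rewrite (trans_ext IH) transD. Qed.

Lemma iter_transZ k c f : iter k K (fun z => c * f z) =1 (fun z => c * iter k K f z).
Proof. by elim: k => //= k IH z; rewrite (trans_ext IH) transZ. Qed.

Lemma iter_trans_cst k c : iter k K (fun=> c) =1 (fun=> c).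
Proof. by elim: k => //= k IH z; rewrite (trans_ext IH) trans_cst. Qed.

Lemma iter_trans_ge0 k f : (forall z, 0 <= f z) -> forall z, 0 <= iter k K f z.
Proof.
move=> f0; elim: k => //= k IH z.
by apply: sumr_ge0 => s _; rewrite mulr_ge0.
Qed.

Variable reset : pred S.
Hypothesis reset_step : forall s z z', reset s -> step s z = step s z'.
Hypothesis reset_pos : 0 < \sum_(s | reset s) nu s.
Variable z0 : Z.

Definition mixing_rate : R := 1 - \sum_(s | reset s) nu s.
Local Notation r := mixing_rate.

Lemma mixing_rateE : r = \sum_(s | ~~ reset s) nu s.
Proof. by rewrite /mixing_rate -[X in X - _]nu_sum1 [X in X - _](bigID reset) /= addrAC subrr add0r. Qed.

Lemma mixing_rate_ge0 : 0 <= r.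
Proof. by rewrite mixing_rateE sumr_ge0. Qed.

Lemma mixing_rate_lt1 : r < 1.
Proof. by rewrite /mixing_rate ltrBlDl ltrDr. Qed.

(** Doeblin's coupling: both copies of the chain use the same letter. A reset merges them, and any
    other letter leaves a difference of at most [c]. *)
Lemma trans_contract f c :
  (forall z z', `|f z - f z'| <= c) -> forall z z', `|K f z - K f z'| <= r * c.
Proof.
move=> fc z z'; rewrite /trans -sumrB (bigID reset) /= big1 ?add0r; last first.
  by move=> s rs; rewrite (reset_step z z' rs) subrr.
apply: le_trans (ler_norm_sum _ _ _) _; rewrite mixing_rateE mulr_suml.
apply: ler_sum => s _; rewrite -mulrBr normrM ger0_norm //.
by apply: ler_wpM2l.
Qed.

Definition osc (f : Z -> R) : R := 2 * \sum_z `|f z|.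

Lemma osc_ge0 f : 0 <= osc f.
Proof. by rewrite mulr_ge0 ?sumr_ge0. Qed.

Lemma le_osc f z z' : `|f z - f z'| <= osc f.
Proof.
apply: le_trans (ler_normB _ _) _; rewrite /osc mulr_natl mulr2n.
by apply: lerD; [rewrite (bigD1 z) | rewrite (bigD1 z')] => //=; rewrite lerDl sumr_ge0.
Qed.

Lemma iter_trans_contract k f z z' : `|iter k K f z - iter k K f z'| <= r ^+ k * osc f.
Proof.
elim: k z z' => [|k IH] z z' /=; first by rewrite expr0 mul1r le_osc.
by rewrite exprS -mulrA; exact: trans_contract.
Qed.

(** The first [j] letters only randomize the starting point, so the contraction over the other [k]
    letters applies under the mean. *)
Lemma iter_trans_cauchy j k f z z' :
  `|iter (j + k) K f z - iter k K f z'| <= r ^+ k * osc f.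
Proof.
rewrite iterD -expect_run -[iter k K f z'](expect_seq_cst nu_sum1 j).
rewrite -[X in _ - X]mul1r -mulNr -expect_seqZ -expect_seqD.
apply: expect_seq_norm => // l _; rewrite mulN1r; exact: iter_trans_contract.
Qed.

(** Stationary means are limits of iterates from [z0], so that no invariant measure is built;
    linearity, positivity and invariance under [K] are derived afterwards. *)
Definition stat (f : Z -> R) : R := limn (fun k => iter k K f z0).

(** The increments of the iterates are dominated by a geometric series, by [iter_trans_cauchy] with
    [j = 1]. *)
Lemma stat_cvg f : (fun k => iter k K f z0) @ \oo --> stat f.
Proof.
rewrite /stat; set u := (fun k => iter k K f z0).
suff: cvgn (series (telescope u)).
  move=> h; suff -> : u = (fun n => u 0%N + series (telescope u) n).
    by apply: is_cvgD => //; exact: is_cvg_cst.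
  by apply/funext => n; exact: eq_sum_telescope.
apply: normed_cvg.
apply: (@series_le_cvg _ _ (geometric (osc f) r)) => [n|n|n|].
- exact: normr_ge0.
- by rewrite /geometric /= mulr_ge0 ?osc_ge0 ?exprn_ge0 ?mixing_rate_ge0.
- rewrite /telescope /geometric /= mulrC; exact: (iter_trans_cauchy 1 n).
- by apply: is_cvg_geometric_series; rewrite ger0_norm ?mixing_rate_ge0 ?mixing_rate_lt1.
Qed.

Lemma stat_rate k f z : `|iter k K f z - stat f| <= r ^+ k * osc f.
Proof.
have h : (fun j => `|iter k K f z - iter (j + k) K f z0|) @ \oo
   --> `|iter k K f z - stat f|.
  apply: cvg_norm; apply: cvgB; first exact: cvg_cst.
  by rewrite (cvg_shiftn k (fun j => iter j K f z0)); exact: stat_cvg.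
apply: (cvgr_to_le h); near=> j; rewrite distrC; exact: iter_trans_cauchy.
Unshelve. all: end_near. Qed.

End RandomMap.

(** * Stationary means *)

Section Stationary.
Variables (R : realType) (S : finType) (nu : S -> R).
Hypothesis nu_ge0 : forall s, 0 <= nu s.
Hypothesis nu_sum1 : \sum_s nu s = 1.
Variables (Z : finType) (step : S -> Z -> Z).
Variable reset : pred S.
Hypothesis reset_step : forall s z z', reset s -> step s z = step s z'.
Hypothesis reset_pos : 0 < \sum_(s | reset s) nu s.
Variable z0 : Z.

Local Notation EN := (expect_seq nu).
Local Notation K := (trans nu step).
Local Notation pi := (stat nu step z0).
Local Notation r := (mixing_rate nu reset).

Let pi_cvg f := stat_cvg nu_ge0 nu_sum1 reset_step reset_pos (z0 := z0) (f := f).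

Lemma stat_unique f l : (fun k => iter k K f z0) @ \oo --> l -> pi f = l.
Proof. by move=> h; apply: cvg_lim. Qed.

Lemma statD f g : pi (f \+ g) = pi f + pi g.
Proof.
apply: stat_unique; under eq_fun do rewrite iter_transD /=.
by apply: cvgD; exact: pi_cvg.
Qed.

Lemma statZ c f : pi (fun z => c * f z) = c * pi f.
Proof.
apply: stat_unique; under eq_fun do rewrite iter_transZ.
by apply: cvgM; [exact: cvg_cst | exact: pi_cvg].
Qed.

Lemma stat_cst c : pi (fun=> c) = c.
Proof.
apply: stat_unique; under eq_fun do rewrite iter_trans_cst //.
exact: cvg_cst.
Qed.

Lemma stat_ext f g : f =1 g -> pi f = pi g.
Proof. by move=> /funext ->. Qed.

Lemma stat_trans f : pi (K f) = pi f.
Proof.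
apply: stat_unique; under eq_fun do rewrite -iterSr.
by have := @pi_cvg f; rewrite -cvg_shiftS.
Qed.

Lemma stat_ge0 f : (forall z, 0 <= f z) -> 0 <= pi f.
Proof.
move=> f0; apply: (cvgr_to_ge (@pi_cvg f)).
by near=> k; apply: iter_trans_ge0.
Unshelve. all: end_near. Qed.

Lemma stat_le f g : (forall z, f z <= g z) -> pi f <= pi g.
Proof.
move=> fg; rewrite -subr_ge0 -[- pi f]mulN1r -statZ -statD; apply: stat_ge0 => z /=.
by rewrite mulN1r subr_ge0.
Qed.

(** Nonnegativity of the stationary variance. *)
Lemma stat_sqr f : pi f ^+ 2 <= pi (fun z => f z ^+ 2).
Proof.
have : 0 <= pi (fun z => (f z - pi f) ^+ 2) by apply: stat_ge0 => z; exact: sqr_ge0.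
have -> : pi (fun z => (f z - pi f) ^+ 2) =
    pi (fun z => f z ^+ 2) + (- (2 * pi f)) * pi f + pi f ^+ 2.
  rewrite -[X in _ + X](stat_cst (pi f ^+ 2)) -[X in _ + X + _]statZ -!statD.
  by apply: stat_ext => z /=; ring.
by move=> h; rewrite -subr_ge0; apply: le_trans h _; rewrite le_eqVlt; apply/orP; left; apply/eqP; ring.
Qed.

(** * A weak law of large numbers for windows of bounded length *)

Section LargeNumbers.
Variables (D : nat) (G : Z -> seq S -> R).
Hypothesis G_window : forall z l, G z (take D l) = G z l.
Hypothesis G_bound : forall z l, `|G z l| <= 1.

Definition window_mean (z : Z) : R := EN D (G z).

Local Notation g := window_mean.
Local Notation L := (pi g).

Definition window_dev (z : Z) (i : nat) (l : seq S) : R :=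
  G (run step z (take i l)) (drop i l) - L.

Local Notation dev := window_dev.

Lemma window_mean_bound z : `|g z| <= 1.
Proof. exact: expect_seq_norm. Qed.

Lemma stat_window_mean_bound : `|L| <= 1.
Proof.
have h z : - 1 <= g z <= 1 by rewrite -ler_norml; exact: window_mean_bound.
rewrite ler_norml; apply/andP; split.
  by rewrite -(stat_cst (- 1)); apply: stat_le => z; case/andP: (h z).
by rewrite -[leRHS](stat_cst 1); apply: stat_le => z; case/andP: (h z).
Qed.

Lemma window_dev_bound z i l : `|dev z i l| <= 2.
Proof.
apply: le_trans (ler_normB _ _) _; rewrite (_ : 2 = 1 + 1) //.
by apply: lerD => //; exact: stat_window_mean_bound.
Qed.

Lemma window_dev_cat z i l1 l2 :
  (i + D <= size l1)%N -> dev z i (l1 ++ l2) = dev z i l1.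
Proof.
move=> sl; have il : (i <= size l1)%N by apply: leq_trans (leq_addr _ _) sl.
rewrite /dev takel_cat // drop_cat.
have [lt|ge] := ltnP i (size l1); last first.
  (* The window opens at the very end of [l1], which forces [D = 0]: it reads no letter. *)
  have ei : i = size l1 by apply/eqP; rewrite eqn_leq il.
  have D0 : D = 0%N by apply/eqP; move: sl; rewrite ei -leqn0 -{2}[size l1]addn0 leq_add2l.
  by rewrite ei drop_size subnn drop0 -G_window D0 take0.
by rewrite -G_window takel_cat ?G_window // size_drop leq_subRL // addnC.
Qed.

(** Given the first [i + D] letters, the earlier deviation is fixed and the later one has
    conditional mean at most [r ^+ e * osc g] in absolute value, where [e] letters separate the two
    windows. For overlapping windows the truncated exponent is 0 and the bound 4 suffices. *)
Lemma window_covariance z i j : (i < j)%N ->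
  `|EN (j + D) (fun l => dev z i l * dev z j l)|
    <= (4 + 2 * osc g) * r ^+ (j - i - D).
Proof.
move=> ij; have r0 := mixing_rate_ge0 nu_ge0 nu_sum1 reset.
have o0 := osc_ge0 g.
have [ijD|ijD] := leqP (i + D) j; last first.
  have -> : (j - i - D = 0)%N by apply/eqP; rewrite -subnDA subn_eq0 ltnW.
  rewrite expr0 mulr1; apply: expect_seq_norm => // l _; rewrite normrM.
  apply: (@le_trans _ _ (2 * 2)); last by lra.
  by apply: ler_pM => //; exact: window_dev_bound.
set e := (j - i - D)%N.
have -> : (j + D = (i + D) + (e + D))%N by rewrite /e -subnDA addnA subnKC.
rewrite expect_seq_cat; apply: expect_seq_norm => // l1 sl1.
rewrite expect_seq_cat.
rewrite (@expect_seq_ext _ _ _ _ _ (fun l2 => dev z i l1 * (g (run step (run step z l1) l2) - L))).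
  rewrite expect_seqZ; rewrite (expect_seqD nu e (fun l2 => g (run step (run step z l1) l2)) (fun=> - L)).
  rewrite expect_seq_cst // expect_run normrM.
  apply: (@le_trans _ _ (2 * (r ^+ e * osc g))).
    by apply: ler_pM => //; [exact: window_dev_bound | exact: stat_rate].
  by rewrite mulrCA mulrC ler_wpM2r ?exprn_ge0 // lerDr.
move=> l2 sl2.
rewrite (@expect_seq_ext _ _ _ _ _ (fun l3 => dev z i l1 * (G (run step (run step z l1) l2) l3 - L))).
  rewrite expect_seqZ (expect_seqD nu D (G _) (fun=> - L)).
  by rewrite expect_seq_cst.
move=> l3 sl3; rewrite window_dev_cat ?sl1 //; congr (_ * _).
have sj : size (l1 ++ l2) = j by rewrite size_cat sl1 sl2 /e -subnDA subnKC.
by rewrite /dev catA -{1}sj take_size_cat // -sj drop_size_cat // run_cat.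
Qed.

Lemma sum_geometric_trunc N : \sum_(k < N) r ^+ (k - D) <= D%:R + (1 - r)^-1.
Proof.
have r0 := mixing_rate_ge0 nu_ge0 nu_sum1 reset.
have r1 := mixing_rate_lt1 reset_pos.
(* Lengthening the range to [D + N] allows a cut exactly where the truncated exponent starts to
   grow. *)
apply: (@le_trans _ _ (\sum_(k < D + N) r ^+ (k - D))).
  rewrite -!(big_mkord xpredT (fun k => r ^+ (k - D))) [leRHS](big_cat_nat (leq0n N) (leq_addl D N)) /=.
  by rewrite lerDl sumr_ge0 // => k _; exact: exprn_ge0.
rewrite big_split_ord /=; apply: lerD.
  under eq_bigr => k _ do rewrite (eqP (_ : (k - D == 0)%N)) ?subn_eq0 1?ltnW // expr0.
  by rewrite sumr_const card_ord.
under eq_bigr do rewrite addKn.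
have := subrX1 r N; rewrite -opprB -[r - 1]opprB mulNr => /oppr_inj h.
rewrite -[leRHS]mul1r ler_pdivlMr ?subr_gt0 // mulrC -h.
by rewrite gerBl exprn_ge0.
Qed.

Definition variance_bound : R :=
  4 + 2 * ((4 + 2 * osc g) * (D%:R + (1 - r)^-1)).

(** Induction on [N]: a new deviation adds its square and twice its covariances with the earlier
    ones, and [sum_geometric_trunc] bounds their total independently of [N]. *)
Lemma window_variance z N :
  EN (N + D) (fun l => (\sum_(1 <= i < N.+1) dev z i l) ^+ 2)
    <= variance_bound * N%:R.
Proof.
have r0 := mixing_rate_ge0 nu_ge0 nu_sum1 reset.
have o0 := osc_ge0 g.
elim: N => [|N IH].
  rewrite mulr0; rewrite (@expect_seq_ext _ _ _ _ _ (fun=> 0)) ?expect_seq_cst // => l _.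
  by rewrite big_geq // expr0n.
rewrite (@expect_seq_ext _ _ _ _ _ (fun l => (\sum_(1 <= i < N.+1) dev z i l) ^+ 2 +
   ( 2 * (\sum_(1 <= i < N.+1) dev z i l * dev z N.+1 l) + dev z N.+1 l ^+ 2))); last first.
  by move=> l _; rewrite big_nat_recr //= -mulr_suml; ring.
rewrite !expect_seqD expect_seqZ expect_seq_sum //.
have h1 : EN (N.+1 + D) (fun l => (\sum_(1 <= i < N.+1) dev z i l) ^+ 2)
  = EN (N + D) (fun l => (\sum_(1 <= i < N.+1) dev z i l) ^+ 2).
  rewrite addSn -addn1 expect_seq_cat; apply: expect_seq_ext => l1 sl1.
  rewrite -[RHS](expect_seq_cst nu_sum1 1); apply: expect_seq_ext => l2 _.
  congr (_ ^+ 2); apply: eq_big_nat => i /andP[_ iN].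
  by rewrite window_dev_cat // sl1 leq_add2r -ltnS.
have h2 : \sum_(1 <= i < N.+1) EN (N.+1 + D) (fun l => dev z i l * dev z N.+1 l)
   <= (4 + 2 * osc g) * (D%:R + (1 - r)^-1).
  apply: (@le_trans _ _ (\sum_(1 <= i < N.+1) (4 + 2 * osc g) * r ^+ (N.+1 - i - D))).
    apply: ler_sum_nat => i /andP[_ iN].
    by apply: le_trans (ler_norm _) _; exact: window_covariance.
  rewrite -mulr_sumr ler_wpM2l //; first by rewrite addr_ge0 // mulr_ge0.
  apply: le_trans (sum_geometric_trunc N.+1).
  rewrite big_nat_rev /= -(big_mkord xpredT (fun k => r ^+ (k - D))).
  rewrite [leRHS]big_nat_recl //= -[leLHS]add0r lerD ?exprn_ge0 // big_add1 /=.
  rewrite le_eqVlt; apply/orP; left; apply/eqP; apply: eq_big_nat => i /andP[_ iN].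
  by congr (_ ^+ (_ - D)); lia.
have h3 : EN (N.+1 + D) (fun l => dev z N.+1 l ^+ 2) <= 4.
  rewrite -[leRHS](expect_seq_cst nu_sum1 (N.+1 + D)); apply: expect_seq_le => // l _.
  rewrite -real_normK ?num_real // (_ : 4 = 2 ^+ 2); last by ring.
  by rewrite ler_sqr ?nnegrE // window_dev_bound.
rewrite h1 -[N.+1%:R]natr1 mulrDr mulr1; apply: lerD => //; rewrite /variance_bound addrC; lra.
Qed.

(** Chebyshev's inequality, with a bound that is uniform in the starting state [z]. *)
Lemma window_chebyshev (z : Z) N (delta : R) : 0 < delta ->
  EN (N.+1 + D) (fun l => ((delta <= `|(N.+1%:R)^-1 *
      (\sum_(1 <= i < N.+2) G (run step z (take i l)) (drop i l)) - L|)%R)%:R)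
    <= variance_bound / delta ^+ 2 / N.+1%:R.
Proof.
move=> d0; have n0 : 0 < N.+1%:R :> R by rewrite ltr0n.
apply: (@le_trans _ _ (EN (N.+1 + D) (fun l =>
   (delta * N.+1%:R) ^- 2 * (\sum_(1 <= i < N.+2) window_dev z i l) ^+ 2))).
  apply: expect_seq_le => // l _.
  have -> : \sum_(1 <= i < N.+2) window_dev z i l =
     N.+1%:R * ((N.+1%:R)^-1 *
      (\sum_(1 <= i < N.+2) G (run step z (take i l)) (drop i l)) - L).
    rewrite /window_dev sumrB sumr_const_nat subSS subn0 mulrBr mulrA mulfV ?gt_eqF // mul1r.
    by rewrite mulr_natl.
  set y := (_ * _ - L); case dy: (delta <= `|y|); last first.
    by rewrite mulr0n mulr_ge0 ?sqr_ge0 // invr_ge0 sqr_ge0.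
  rewrite mulrC ler_pdivlMr ?mul1r ?exprn_gt0 ?mulr_gt0 //.
  rewrite !exprMn mulrC ler_wpM2l ?sqr_ge0 //.
  by rewrite -[leRHS]real_normK ?num_real // ler_sqr ?nnegrE // ltW.
rewrite expect_seqZ; apply: le_trans (_ : _ <= (delta * N.+1%:R) ^- 2 * (variance_bound * N.+1%:R)) _.
  by rewrite ler_wpM2l ?window_variance // invr_ge0 sqr_ge0.
rewrite le_eqVlt; apply/orP; left; apply/eqP.
by field; rewrite !gt_eqF //.
Qed.

End LargeNumbers.
End Stationary.

(** * The joint law of the variables driving the model *)

Lemma independent_seq (R : realType) (dsp : measure_display)
    (Omega : measurableType dsp) (P : probability Omega R)
    (I : choiceType) (E : I -> set (set Omega)) (s : seq I) (A : I -> set Omega) :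
  independent_classes P E -> uniq s -> (forall i, i \in s -> E i (A i)) ->
  P (\bigcap_(i in [set` s]) A i) = (\prod_(i <- s) P (A i))%E.
Proof.
move=> ind us EA; have mem_s : [fset x in s]%fset =i s by move=> x; rewrite in_fset.
have -> : [set` s] = [set` [fset x in s]%fset].
  by apply/seteqP; split=> x /=; rewrite mem_s.
rewrite ind => [|i]; last by rewrite mem_s; exact: EA.
by apply: perm_big; apply: uniq_perm => //; exact: fset_uniq.
Qed.

Lemma probability_bernoulli (R : realType) (dsp : measure_display)
    (Omega : measurableType dsp) (P : probability Omega R) (p : R)
    (X : {RV P >-> bool}) (b : bool) : 0 <= p <= 1 ->
  distribution P X =1 bernoulli_prob p ->
  P (X @^-1` [set b]) = (if b then p else 1 - p)%:E.
Proof.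
move=> p01 /(_ [set b]) h; rewrite -[LHS]/(distribution P X [set b]) h.
rewrite bernoulli_probE // !diracE; case: b {h}.
  by rewrite mem_set // memNset //= mule1 mule0 adde0.
by rewrite memNset // mem_set //= mule1 mule0 add0e.
Qed.

Lemma prob_fin_partition (R : realType) (dsp : measure_display)
    (Omega : measurableType dsp) (P : probability Omega R)
    (I : finType) (X : Omega -> I) (Q : pred I) (p : I -> R) :
  (forall i, measurable (X @^-1` [set i])) ->
  (forall i, P (X @^-1` [set i]) = (p i)%:E) ->
  measurable [set w | Q (X w)] /\
  P [set w | Q (X w)] = (\sum_i p i * (Q i)%:R)%:E.
Proof.
move=> mX pX.
have -> : [set w | Q (X w)] = \bigcup_(i in [set i | Q i]) X @^-1` [set i].
  apply/seteqP; split=> [w /= Qw|w /= [i Qi /= ->//]].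
  by exists (X w).
have fQ : finite_set [set i | Q i] by exact: finite_finset.
split.
  by apply: fin_bigcup_measurable.
rewrite measure_fin_bigcup //; last first.
  by move=> i j _ _ [w [/= <- <-]].
rewrite (fsbigE [seq i <- index_enum I | Q i]) /=; first last.
- by move=> i /= Qi; rewrite mem_filter mem_index_enum Qi.
- by move=> i /=; rewrite mem_filter => /andP[].
- by rewrite filter_uniq // index_enum_uniq.
rewrite big_filter_cond /= -sumEFin big_mkcond /=; apply: eq_bigr => i _.
rewrite pX; case Qi : (Q i); last by rewrite mulr0.
by rewrite mulr1 mem_set.
Qed.

Section Noise.
Variables (R : realType) (n m : nat) (eps : R).

Local Notation V := ('I_n + 'I_m)%type.

Definition bip_deg (v : V) : nat := if v is inl _ then m else n.

(** A letter at a site is the triple of [xi], [Y] and [eta]. The third entry ranges over all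
    vertices, with weight 0 off the neighbourhood, so that one finite alphabet serves every site. *)
Definition site_pmf (v : V) (x : bool * bool * V) : R :=
  (if x.1.1 then eps else 1 - eps)
  * (2^-1 * (if bip_adj v x.2 then (bip_deg v)%:R^-1 else 0)).

Definition noise := {ffun V -> bool * bool * V}.
Definition config := {ffun V -> bool}.

Definition noise_pmf (s : noise) : R := \prod_v site_pmf v (s v).

Definition init_pmf (z : config) : R := \prod_(v : V) 2^-1.

(** The guard [bip_adj] returns false when [eta] misses the neighbourhood, just as the sum in
    [nvm_state] is then 0; hence [nvm_stateE] holds at every sample point and not only almost
    surely. *)
Definition nvm_step (s : noise) (z : config) : config :=
  [ffun v => if (s v).1.1 then (s v).1.2 else bip_adj v (s v).2 && z (s v).2].

Lemma card_bip_nbr (v : V) : #|` bip_nbr v| = bip_deg v.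
Proof.
rewrite /bip_nbr card_finset -sum1_card big_mkcond big_sumType /=.
case: v => i.
  by rewrite [X in (X + _)%N]big1 // sum1_card card_ord.
by rewrite [X in (_ + X)%N]big1 // addn0 sum1_card card_ord.
Qed.

Section Realization.
Variables (dsp : measure_display) (Omega : measurableType dsp).
Variables (P : probability Omega R) (N : nvm P (complete_bipartite n m) eps).

Definition init_at (w : Omega) : config := [ffun v => X0 N v w].

Definition noise_at (t : nat) (w : Omega) : noise :=
  [ffun v => (xi N t v w, Y N t v w, Defs.eta N t v w)].

Definition history (t : nat) (w : Omega) : t.-tuple noise :=
  [tuple noise_at i.+1 w | i < t].

Lemma nth_history s0 t i w : (i < t)%N ->
  nth s0 (history t w) i = noise_at i.+1 w.
Proof.
by move=> it; rewrite -[i in LHS]/(val (Ordinal it)) -tnth_nth tnth_mktuple.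
Qed.

Lemma history_rcons t w :
  history t.+1 w = rcons (history t w) (noise_at t.+1 w) :> seq noise.
Proof.
apply: (@eq_from_nth _ (noise_at 0 w)); rewrite ?size_rcons !size_tuple // => i it.
rewrite nth_rcons size_tuple; have [lt|] := ltnP i t.
  by rewrite !nth_history.
by move=> ti; have -> : i = t by [lia]; rewrite eqxx nth_history ?ltnSn.
Qed.

Lemma take_history t k w : (t <= k)%N -> take t (history k w) = history t w.
Proof.
elim: k => [|k IH] tk.
  by move: tk; rewrite leqn0 => /eqP ->; rewrite (size0nil (size_tuple (history 0 w))).
move: tk; rewrite leq_eqVlt => /orP[/eqP ->|tk]; first by rewrite take_oversize // size_tuple.
by rewrite history_rcons -cats1 takel_cat ?size_tuple // IH.
Qed.

Lemma nvm_stateE t u w :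
  nvm_state N t u w = run nvm_step (init_at w) (history t w) u :> nat.
Proof.
elim: t u => [|t IH] u.
  by rewrite (size0nil (size_tuple (history 0 w))) /= ffunE.
rewrite history_rcons -cats1 run_cat /= !ffunE /=.
case: (xi N t.+1 u w) => /=; first by case: (Y _ _ _ _).
rewrite mul0n add0n mul1n.
set e := Defs.eta N t.+1 u w.
rewrite (eq_bigr (fun v => if v == e then run nvm_step (init_at w) (history t w) e : nat else 0%N)); last first.
  by move=> v _; rewrite eq_sym IH; case: eqP => [->|]; rewrite ?mul0n ?mul1n.
rewrite -in_bip_nbr -big_mkcond /= -big_filter.
have [eN|eN] := boolP (e \in bip_nbr u).
  by rewrite filter_pred1_uniq ?big_seq1 // fset_uniq.
rewrite (eqP (_ : [seq v <- bip_nbr u | v == e] == [::])) ?big_nil //.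
by rewrite -[_ == _]negbK -has_filter has_pred1.
Qed.

Local Notation source_index T := (V + ('I_T * V + ('I_T * V + 'I_T * V)))%type.

Definition source_of T (i : source_index T) : source V :=
  match i with
  | inl v => src_X0 v
  | inr (inl (t, v)) => src_xi t v
  | inr (inr (inl (t, v))) => src_Y t v
  | inr (inr (inr (t, v))) => src_eta t v
  end.

Lemma source_of_inj T : injective (@source_of T).
Proof.
by move=> [v|[[t v]|[[t v]|[t v]]]] [v'|[[t' v']|[[t' v']|[t' v']]]] //= [];
  first [by move=> -> | by move=> /val_inj -> ->].
Qed.

(** Only sources with a time index below the length of [l] are considered, so the default letter of
    [nth] is never read. *)
Definition source_event (z : config) (l : seq noise) (s : source V) : set Omega :=
  match s with
  | src_X0 v => X0 N v @^-1` [set z v]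
  | src_xi t v => xi N t.+1 v @^-1` [set (nth [ffun v => (true, true, v)] l t v).1.1]
  | src_Y t v => Y N t.+1 v @^-1` [set (nth [ffun v => (true, true, v)] l t v).1.2]
  | src_eta t v => Defs.eta N t.+1 v @^-1` [set (nth [ffun v => (true, true, v)] l t v).2]
  end.

Lemma init_historyE T (z : config) (l : T.-tuple noise) :
  [set w | (init_at w, history T w) = (z, l)] =
  \bigcap_(s in [set` [seq source_of i | i <- index_enum (source_index T)]])
    source_event z l s.
Proof.
apply/seteqP; split=> w /=.
  move=> /pair_equal_spec[<- <-] s /mapP[[v|[[t v]|[[t v]|[t v]]]] _ ->].
  - by rewrite /= ffunE.
  - by rewrite /source_event /source_of nth_history //= ffunE.
  - by rewrite /source_event /source_of nth_history //= ffunE.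
  - by rewrite /source_event /source_of nth_history //= ffunE.
move=> h; have {}h (i : source_index T) : source_event z l (source_of i) w.
  by apply: h; apply/mapP; exists i => //; exact: mem_index_enum.
congr (_, _).
  by apply/ffunP => v; rewrite ffunE; exact: (h (inl v)).
apply: eq_from_tnth => t; rewrite tnth_mktuple; apply/ffunP => v; rewrite ffunE.
have /= h1 := h (inr (inl (t, v))).
have /= h2 := h (inr (inr (inl (t, v)))).
have /= h3 := h (inr (inr (inr (t, v)))).
by rewrite h1 h2 h3 -!tnth_nth -!surjective_pairing.
Qed.

Hypothesis eps01 : 0 < eps < 1.

Lemma prob_source_event T (z : config) (l : T.-tuple noise) (i : source_index T) :
  measurable (source_event z l (source_of i)) /\
  P (source_event z l (source_of i)) =
   (match i with
    | inl _ => 2^-1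
    | inr (inl (t, v)) => if (tnth l t v).1.1 then eps else 1 - eps
    | inr (inr (inl _)) => 2^-1
    | inr (inr (inr (t, v))) =>
        if bip_adj v (tnth l t v).2 then (bip_deg v)%:R^-1 else 0
    end)%:E.
Proof.
have half : 0 <= (2^-1 : R) <= 1 by lra.
have half' : 1 - 2^-1 = 2^-1 :> R by field.
have e01 : 0 <= eps <= 1 by case/andP: eps01 => e0 e1; rewrite !ltW.
have mRV (X : {RV P >-> bool}) b : measurable (X @^-1` [set b]).
  exact: measurable_funPTI.
case: i => [v|[[t v]|[[t v]|[t v]]]] /=; split=> //.
- by rewrite (@probability_bernoulli _ _ _ _ _ (X0 N v) _ half (X0_bern N v)) half' if_same.
- by rewrite (probability_bernoulli _ e01 (xi_bern N v (ltn0Sn t))) -tnth_nth.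
- by rewrite (probability_bernoulli _ half (Y_bern N v (ltn0Sn t))) half' if_same.
- exact: eta_meas.
- by rewrite -tnth_nth (eta_unif N v _ (ltn0Sn t)) /= in_bip_nbr card_bip_nbr.
Qed.

(** The event is a finite intersection with one event per source, so independence gives a product,
    which is then regrouped by time and by site. *)
Lemma prob_init_history T (z : config) (l : T.-tuple noise) :
  measurable [set w | (init_at w, history T w) = (z, l)] /\
  P [set w | (init_at w, history T w) = (z, l)] =
   (init_pmf z * \prod_(t < T) noise_pmf (tnth l t))%:E.
Proof.
rewrite init_historyE; split.
  have fs : finite_set [set` [seq source_of i | i <- index_enum (source_index T)]].
    exact: finite_seq.
  apply: fin_bigcap_measurable => // s /= /mapP[i _ ->].
  exact: (prob_source_event z l i).1.
rewrite (independent_seq (@nvm_indep _ _ _ _ _ _ N)); first last.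
- move=> s /mapP[[v|[[t v]|[[t v]|[t v]]]] _ ->] ; by eexists.
- by rewrite map_inj_uniq ?index_enum_uniq //; exact: source_of_inj.
rewrite big_map; under eq_bigr => i _ do rewrite (prob_source_event z l i).2.
rewrite prodEFin; congr (_%:E).
rewrite big_sumType; congr (_ * _); rewrite big_sumType /= [X in _ * X]big_sumType /=.
have pr (F : 'I_T -> V -> R) (H : 'I_T * V -> R) :
    (forall t v, H (t, v) = F t v) -> \prod_p H p = \prod_t \prod_v F t v.
  by move=> FH; rewrite pair_bigA; apply: eq_bigr => -[t v] _; exact: FH.
rewrite (pr (fun t v => if (tnth l t v).1.1 then eps else 1 - eps)) //.
rewrite (pr (fun _ _ => 2^-1)) //.
rewrite (pr (fun t v => if bip_adj v (tnth l t v).2 then (bip_deg v)%:R^-1 else 0)) //.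
rewrite -!big_split; apply: eq_bigr => t _.
by rewrite -!big_split.
Qed.

(** The bridge from the given probability space to finite sums. It serves the law of large numbers,
    the meeting events and the star observations alike. *)
Lemma prob_history (Q : config -> seq noise -> bool) T :
  measurable [set w | Q (init_at w) (history T w)] /\
  P [set w | Q (init_at w) (history T w)] =
   (\sum_z init_pmf z * expect_seq noise_pmf T (fun l => (Q z l)%:R))%:E.
Proof.
have := @prob_fin_partition R dsp Omega P (config * T.-tuple noise)%type
  (fun w => (init_at w, history T w)) (fun zl => Q zl.1 zl.2)
  (fun zl => init_pmf zl.1 * \prod_(t < T) noise_pmf (tnth zl.2 t)).
case=> [[z l]|[z l]|m1 ->].
- exact: (prob_init_history z l).1.
- exact: (prob_init_history z l).2.
split=> //; congr (_%:E).
rewrite -(pair_bigA _ (fun z (l : T.-tuple noise) => init_pmf z * \prod_(t < T) noise_pmf (tnth l t) * (Q z l)%:R)) /=.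
apply: eq_bigr => z _; rewrite expect_seq_tuple mulr_sumr.
by apply: eq_bigr => l _; rewrite mulrA.
Qed.

End Realization.
End Noise.

(** * The transition kernel of the voter model on a complete bipartite graph *)

Section Kernel.
Variables (R : realType) (n m : nat) (eps : R).
Hypotheses (n_gt0 : (0 < n)%N) (m_gt0 : (0 < m)%N) (eps01 : 0 < eps < 1).

Local Notation V := ('I_n + 'I_m)%type.
Local Notation noise := (noise n m).
Local Notation config := (config n m).
Local Notation nu := (@noise_pmf R n m eps).
Local Notation site := (@site_pmf R n m eps).
Local Notation step := (@nvm_step n m).
Local Notation K := (trans nu step).

Definition nbr_mean (v : V) (g : V -> R) : R :=
  match v with
  | inl _ => m%:R^-1 * \sum_(j < m) g (inr j)
  | inr _ => n%:R^-1 * \sum_(i < n) g (inl i)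
  end.

Lemma nbr_meanE v g :
  \sum_w (if bip_adj v w then (bip_deg v)%:R^-1 else 0) * g w = nbr_mean v g.
Proof.
rewrite big_sumType /=; case: v => i /=.
  by rewrite big1 ?add0r ?mulr_sumr // => j _; rewrite mul0r.
by rewrite [X in _ + X]big1 ?addr0 ?mulr_sumr // => j _; rewrite mul0r.
Qed.

Lemma nbr_mean_cst v c : nbr_mean v (fun=> c) = c.
Proof.
by case: v => i /=; rewrite sumr_const card_ord -[c *+ _]mulr_natl mulKf // pnatr_eq0 -lt0n.
Qed.

Lemma site_sum v (H : bool * bool * V -> R) :
  \sum_x site v x * H x =
  eps * (2^-1 * (nbr_mean v (fun w => H (true, true, w)) + nbr_mean v (fun w => H (true, false, w))))
  + (1 - eps) * (2^-1 * (nbr_mean v (fun w => H (false, true, w)) + nbr_mean v (fun w => H (false, false, w)))).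
Proof.
have -> : \sum_x site v x * H x =
    \sum_(b : bool) \sum_(c : bool) \sum_w site v (b, c, w) * H (b, c, w).
  by rewrite !pair_bigA /=; apply: eq_bigr => -[[b c] w].
rewrite !big_bool /= -!nbr_meanE -!big_split /= !mulr_sumr -big_split /=.
by apply: eq_bigr => w _; rewrite /site_pmf /=; ring.
Qed.

Lemma site_sum1 v : \sum_x site v x = 1.
Proof.
by under eq_bigr do rewrite -[site v _]mulr1; rewrite site_sum !nbr_mean_cst; field.
Qed.

Lemma site_ge0 v x : 0 <= site v x.
Proof.
case/andP: eps01 => e0 e1; rewrite /site_pmf mulr_ge0 //; first by case: ifP => _; lra.
by rewrite mulr_ge0 ?invr_ge0 //; case: ifP.
Qed.

(** Independence of the sites, in the form from which the marginals and [trans_spin_prod] follow. *)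
Lemma noise_prod (h : V -> bool * bool * V -> R) :
  \sum_s nu s * \prod_v h v (s v) = \prod_v \sum_x site v x * h v x.
Proof.
rewrite bigA_distr_bigA /=; apply: eq_bigr => s _.
by rewrite /noise_pmf -big_split.
Qed.

Lemma noise_pmf_ge0 s : 0 <= nu s.
Proof. by apply: prodr_ge0 => v _; exact: site_ge0. Qed.

Lemma noise_pmf_sum1 : \sum_s nu s = 1.
Proof.
have -> : \sum_s nu s = \sum_s nu s * \prod_(v : V) 1.
  by apply: eq_bigr => s _; rewrite big1_eq mulr1.
rewrite (noise_prod (fun _ _ => 1)) big1 // => v _.
by under eq_bigr do rewrite mulr1; exact: site_sum1.
Qed.

Lemma init_pmf_ge0 (z : config) : 0 <= init_pmf R z.
Proof. by apply: prodr_ge0 => v _; rewrite invr_ge0. Qed.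

Lemma init_pmf_sum1 : \sum_(z : config) init_pmf R z = 1.
Proof.
rewrite /init_pmf -(bigA_distr_bigA (fun (_ : V) (_ : bool) => 2^-1)) big1 // => v _.
by rewrite big_bool /=; field.
Qed.

Definition refresh (s : noise) : bool := [forall v, (s v).1.1].

Lemma refresh_step s z z' : refresh s -> step s z = step s z'.
Proof. by move=> /forallP h; apply/ffunP => v; rewrite !ffunE h. Qed.

Lemma refresh_pos : 0 < \sum_(s | refresh s) nu s.
Proof.
(* An explicit reset of positive weight: every [eta] has to point to a neighbour, hence the choice
   by parts. *)
pose s0 : noise := [ffun v : V => (true, true,
  match v with inl _ => inr (Ordinal m_gt0) | inr _ => inl (Ordinal n_gt0) end)].
case/andP: eps01 => e0 e1.
rewrite (bigD1 s0) /=; last by apply/forallP => v; rewrite ffunE.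
apply: ltr_pwDl; last by apply: sumr_ge0 => s _; exact: noise_pmf_ge0.
apply: prodr_gt0 => v _; rewrite /site_pmf ffunE /=.
by case: v => i /=; rewrite !mulr_gt0 // invr_gt0 ltr0n.
Qed.

Lemma noise_marginal v (H : bool * bool * V -> R) :
  \sum_s nu s * H (s v) = \sum_x site v x * H x.
Proof.
have := noise_prod (fun u x => if u == v then H x else 1).
rewrite (bigD1 v) //= [X in _ = _ * X]big1 => [|u /negbTE uv]; last first.
  by rewrite uv; under eq_bigr do rewrite mulr1; exact: site_sum1.
rewrite mulr1 eqxx => <-; apply: eq_bigr => s _.
by rewrite (bigD1 v) //= eqxx big1 ?mulr1 // => u /negbTE ->.
Qed.

Lemma noise_marginal2 v w (H : bool * bool * V -> bool * bool * V -> R) : v != w ->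
  \sum_s nu s * H (s v) (s w) = \sum_x \sum_y site v x * site w y * H x y.
Proof.
move=> vw; rewrite exchange_big /=.
(* Fixing the letter at [w] by an indicator turns [H] into a product over sites, to which
   [noise_prod] applies; the sum over [y] is taken at the end. *)
have h y : \sum_s nu s * (H (s v) y * (s w == y)%:R) = \sum_x site v x * site w y * H x y.
  have hw : \sum_x site w x * (x == y)%:R = site w y.
    rewrite (bigD1 y) //= eqxx mulr1 big1 ?addr0 // => x /negbTE ->.
    by rewrite mulr0.
  have wv : (w == v) = false by rewrite eq_sym (negbTE vw).
  have := noise_prod (fun u x => if u == v then H x y else if u == w then (x == y)%:R else 1).
  rewrite (bigD1 v) //= (bigD1 w) ?wv //= [X in _ = _ * (_ * X)]big1; last first.
    move=> u /andP[/negbTE uv /negbTE uw]; rewrite uv uw.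
    by under eq_bigr do rewrite mulr1; exact: site_sum1.
  rewrite !eqxx mulr1 hw.
  move=> e; transitivity ((\sum_x site v x * H x y) * site w y); last first.
    by rewrite mulr_suml; apply: eq_bigr => x _; rewrite mulrAC.
  rewrite -e; apply: eq_bigr => s _; congr (_ * _).
  rewrite (bigD1 v) //= (bigD1 w) ?wv //= big1 ?mulr1; last first.
    by move=> u /andP[/negbTE uv /negbTE uw]; rewrite uv uw.
  by rewrite !eqxx.
under [RHS]eq_bigr do rewrite -h.
rewrite exchange_big /=; apply: eq_bigr => s _; rewrite -mulr_sumr; congr (_ * _).
rewrite (bigD1 (s w)) //= eqxx mulr1 big1 ?addr0 // => y /negbTE yw.
by rewrite eq_sym yw mulr0.
Qed.

Definition spin (z : config) (v : V) : R := if z v then 1 else -1.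

Lemma spinM z v : spin z v * spin z v = 1.
Proof. by rewrite /spin; case: (z v); rewrite ?mulrNN mulr1. Qed.

Definition drift (z : config) (v : V) : R := (1 - eps) * nbr_mean v (spin z).

(** Given the present, the new spins at distinct vertices are independent. A fresh opinion has mean
    0, so only copying contributes to the conditional mean [drift]. *)
Lemma trans_spin_prod (A : {set V}) z :
  K (fun z' => \prod_(v in A) spin z' v) z = \prod_(v in A) drift z v.
Proof.
have upd v s : spin (step s z) v =
    if (s v).1.1 then (if (s v).1.2 then 1 else -1)
    else if bip_adj v (s v).2 then spin z (s v).2 else -1.
  by rewrite /spin ffunE; case: (s v).1.1 => //; case: bip_adj.
have -> : K (fun z' => \prod_(v in A) spin z' v) z =
  \sum_s nu s * \prod_v (if v \in A then
    if (s v).1.1 then (if (s v).1.2 then 1 else -1)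
    else if bip_adj v (s v).2 then spin z (s v).2 else -1 else 1).
  apply: eq_bigr => s _; congr (_ * _); rewrite big_mkcond /=.
  by apply: eq_bigr => v _; rewrite upd.
rewrite (noise_prod (fun v x => if v \in A then
    if x.1.1 then (if x.1.2 then 1 else -1)
    else if bip_adj v x.2 then spin z x.2 else -1 else 1)).
rewrite [RHS]big_mkcond /=; apply: eq_bigr => v _; case: ifP => vA; last first.
  by under eq_bigr do rewrite mulr1; exact: site_sum1.
rewrite site_sum /= !nbr_mean_cst /drift subrr mulr0 mulr0 add0r.
set X := nbr_mean _ _; have -> : 2^-1 * (X + X) = X by field.
by rewrite /X; case: (v).
Qed.

End Kernel.

(** * Moments of the mean spins *)

Lemma retention_bounds (R : realType) (eps : R) : 0 < eps < 1 -> 0 < (1 - eps) ^+ 2 < 1.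
Proof.
case/andP=> e0 e1; rewrite exprn_gt0 ?subr_gt0 //=.
by rewrite expr_lt1 ?subr_ge0 ?ltW // gtrBl.
Qed.

Lemma inv_nat_bounds (R : realType) (k : nat) : (0 < k)%N -> 0 < (k%:R^-1 : R) <= 1.
Proof.
by move=> k0; rewrite invr_gt0 ltr0n k0 /= invf_le1 ?ltr0n // ler1n.
Qed.

Section PartMoments.
Variables (R : realType) (n m : nat) (eps : R).
Hypotheses (n_gt0 : (0 < n)%N) (m_gt0 : (0 < m)%N) (eps01 : 0 < eps < 1).

Local Notation V := ('I_n + 'I_m)%type.
Local Notation noise := (noise n m).
Local Notation config := (config n m).
Local Notation nu := (@noise_pmf R n m eps).
Local Notation site := (@site_pmf R n m eps).
Local Notation step := (@nvm_step n m).
Local Notation K := (trans nu step).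
Local Notation spin := (@spin R n m).

Lemma trans_sum (I : finType) (F : I -> config -> R) z :
  K (fun z' => \sum_i F i z') z = \sum_i K (F i) z.
Proof.
by rewrite /trans exchange_big /=; apply: eq_bigr => s _; rewrite mulr_sumr.
Qed.

Variables (k : nat) (f : 'I_k -> V).
Hypothesis k_gt0 : (0 < k)%N.
Hypothesis f_inj : injective f.
Hypothesis f_adj : forall i j, bip_adj (f i) =1 bip_adj (f j).
Hypothesis f_deg : forall i j, bip_deg (f i) = bip_deg (f j).

(** A part is presented by an injection [f] into vertices with common neighbours, so that the
    computations below serve both sides of the graph. *)
Definition part_mean (z : config) : R := k%:R^-1 * \sum_i spin z (f i).

Let k_neq0 : k%:R != 0 :> R. Proof. by rewrite pnatr_eq0 -lt0n. Qed.

Lemma sum_cst (c : R) : \sum_(j < k) c = k%:R * c.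
Proof. by rewrite sumr_const card_ord mulr_natl. Qed.

(** Exchanging the letters of two vertices of the part preserves the noise law and exchanges their
    new spins. The configuration [z] stays fixed because both vertices have the same neighbours. *)
Lemma trans_tperm i j (g : config -> R) z :
  K (fun z' => g [ffun v => z' (tperm (f i) (f j) v)]) z = K g z.
Proof.
set tau := tperm (f i) (f j).
have tauP v : (bip_adj (tau v) =1 bip_adj v) /\ (bip_deg (tau v) = bip_deg v).
  by rewrite /tau; case: tpermP => [->|->|].
pose tw (s : noise) : noise := [ffun v => s (tau v)].
have twK : involutive tw by move=> s; apply/ffunP => v; rewrite !ffunE tpermK.
rewrite /trans [RHS](reindex_inj (inv_inj twK)); apply: eq_bigr => s _.
congr (_ * g _).
  rewrite /noise_pmf [LHS](reindex_inj (@perm_inj _ tau)); apply: eq_bigr => v _.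
  by rewrite ffunE /site_pmf (tauP v).1 (tauP v).2.
by apply/ffunP => v; rewrite !ffunE (tauP v).1.
Qed.

(* Exchangeability within a part: conditionally on the past, every spin of the
   part has the same correlation with powers of the mean, hence so does the
   mean itself. *)
Lemma trans_spin_mean p i z :
  K (fun z' => spin z' (f i) * part_mean z' ^+ p) z = K (fun z' => part_mean z' ^+ p.+1) z.
Proof.
have sw j : K (fun z' => spin z' (f j) * part_mean z' ^+ p) z
          = K (fun z' => spin z' (f i) * part_mean z' ^+ p) z.
  rewrite -[RHS](trans_tperm i j); apply: eq_bigr => s _; congr (_ * (_ * _ ^+ p)).
    by rewrite /spin [in RHS]ffunE tpermL.
  rewrite /part_mean; congr (_ * _); rewrite [LHS](reindex_inj (@perm_inj _ (tperm i j))).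
  by apply: eq_bigr => l _; rewrite /spin [in RHS]ffunE -inj_tperm.
have -> : K (fun z' => part_mean z' ^+ p.+1) z =
    K (fun z' => k%:R^-1 * \sum_j spin z' (f j) * part_mean z' ^+ p) z.
  by apply: eq_bigr => s _; congr (_ * _); rewrite exprS {1}/part_mean -mulr_suml mulrA.
rewrite transZ trans_sum; under eq_bigr do rewrite sw.
by rewrite sum_cst mulKf.
Qed.

Variables (z : config) (mu : R).
Hypothesis drift_f : forall i, drift eps z (f i) = mu.

Let spin_prod := @trans_spin_prod R n m eps n_gt0 m_gt0.

Lemma trans_spin1 i : K (fun z' => spin z' (f i)) z = mu.
Proof.
have := spin_prod [set f i]%SET z; rewrite big_set1 drift_f => <-.
by apply: trans_ext => z'; rewrite big_set1.
Qed.

Lemma trans_spin2 i j :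
  K (fun z' => spin z' (f i) * spin z' (f j)) z = mu ^+ 2 + (j == i)%:R * (1 - mu ^+ 2).
Proof.
have [->|ij] := eqVneq j i.
  rewrite (@trans_ext _ _ _ _ _ _ (fun=> 1)) => [|z']; last exact: spinM.
  by rewrite trans_cst ?noise_pmf_sum1 //=; ring.
have fij : f i \notin [set f j]%SET by rewrite inE (inj_eq f_inj) eq_sym.
have := spin_prod (f i |: [set f j])%SET z.
rewrite big_setU1 //= big_set1 !drift_f mul0r addr0 expr2 => <-.
by apply: trans_ext => z'; rewrite big_setU1 // big_set1.
Qed.

(** Since spins square to 1, a coincidence of indices collapses the product to one spin. The
    indicators let [sum_delta] evaluate the sums over the indices. *)
Lemma trans_spin3 i j l :
  K (fun z' => spin z' (f i) * spin z' (f j) * spin z' (f l)) z =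
  if j == i then mu else mu ^+ 3 + ((l == i)%:R + (l == j)%:R) * (mu - mu ^+ 3).
Proof.
have [->|ij] := eqVneq j i.
  rewrite -(trans_spin1 l); apply: trans_ext => z'; by rewrite spinM mul1r.
have [->|il] := eqVneq l i.
  rewrite (eq_sym i) (negbTE ij) (@trans_ext _ _ _ _ _ _ (fun z' => spin z' (f j))) => [|z'].
    by rewrite trans_spin1 /=; ring.
  by rewrite mulrAC spinM mul1r.
have [->|jl] := eqVneq l j.
  rewrite (@trans_ext _ _ _ _ _ _ (fun z' => spin z' (f i))) => [|z'].
    by rewrite trans_spin1 /=; ring.
  by rewrite -mulrA spinM mulr1.
have -> : mu ^+ 3 + (0 + 0) * (mu - mu ^+ 3) = mu * (mu * mu) by ring.
have fjl : f j \notin [set f l]%SET by rewrite inE (inj_eq f_inj) eq_sym.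
have fij : f i \notin (f j |: [set f l])%SET.
  by rewrite !inE !(inj_eq f_inj) negb_or eq_sym ij eq_sym.
have := spin_prod (f i |: (f j |: [set f l]))%SET z.
rewrite big_setU1 //= big_setU1 //= big_set1 !drift_f => <-.
by apply: trans_ext => z'; rewrite big_setU1 //= big_setU1 //= big_set1 mulrA.
Qed.

Lemma sum_delta (i : 'I_k) : \sum_(j < k) (j == i)%:R = 1 :> R.
Proof. by rewrite (bigD1 i) //= eqxx big1 ?addr0 // => j /negbTE ->. Qed.

Lemma trans_part_mean : K part_mean z = mu.
Proof.
rewrite transZ trans_sum; under eq_bigr do rewrite trans_spin1.
by rewrite sum_cst mulKf.
Qed.

Lemma trans_part_mean2 :
  K (fun z' => part_mean z' ^+ 2) z = k%:R^-1 + (1 - k%:R^-1) * mu ^+ 2.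
Proof.
rewrite -(trans_spin_mean 1 (Ordinal k_gt0)); set i := Ordinal k_gt0.
rewrite (@trans_ext _ _ _ _ _ _ (fun z' => k%:R^-1 * \sum_j spin z' (f i) * spin z' (f j))); last first.
  by move=> z'; rewrite expr1 /part_mean mulrCA mulr_sumr.
rewrite transZ trans_sum; under eq_bigr do rewrite trans_spin2.
rewrite big_split /= -[X in _ + X]mulr_suml sum_delta sum_cst.
by field.
Qed.

(** By [trans_spin_mean] one factor becomes the spin of a fixed vertex, so a double sum replaces the
    triple sum. *)
Lemma trans_part_mean3 :
  K (fun z' => part_mean z' ^+ 3) z =
  mu * (k%:R^-1 * (3 - 2 * k%:R^-1) + (1 - k%:R^-1) * (1 - 2 * k%:R^-1) * mu ^+ 2).
Proof.
rewrite -(trans_spin_mean 2 (Ordinal k_gt0)); set i := Ordinal k_gt0.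
rewrite (@trans_ext _ _ _ _ _ _ (fun z' => k%:R^-1 ^+ 2 *
    \sum_j \sum_l spin z' (f i) * spin z' (f j) * spin z' (f l))); last first.
  move=> z'; rewrite /part_mean exprMn mulrCA; congr (_ * _).
  under [RHS]eq_bigr do rewrite -mulr_sumr.
  by rewrite -mulr_suml -mulr_sumr -mulrA expr2.
rewrite transZ trans_sum.
rewrite (eq_bigr (fun j => k%:R * mu ^+ 3 + 2 * (mu - mu ^+ 3) +
   (j == i)%:R * (k%:R * mu - (k%:R * mu ^+ 3 + 2 * (mu - mu ^+ 3))))); last first.
  move=> j _; rewrite trans_sum; under eq_bigr do rewrite trans_spin3.
  have [ij|ij] := boolP (j == i).
    by rewrite sum_cst /=; ring.
  rewrite big_split /= -[X in _ + X]mulr_suml big_split /= !sum_delta sum_cst /=.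
  ring.
rewrite big_split /= -[X in _ + X]mulr_suml sum_delta sum_cst.
by field.
Qed.

End PartMoments.

Ltac nonneg := repeat first
  [ assumption | exact: sqr_ge0 | exact: ltW | by rewrite subr_ge0
  | by rewrite subr_ge0 ltW | exact: ler0n | apply: mulr_ge0 | apply: addr_ge0 ].

(** * Stationary moments and correlations of the root at several times *)

Section StationaryMoments.
Variables (R : realType) (n m : nat) (eps : R).
Hypotheses (n_gt0 : (0 < n)%N) (m_gt0 : (0 < m)%N) (eps01 : 0 < eps < 1).

Local Notation V := ('I_n + 'I_m)%type.
Local Notation noise := (noise n m).
Local Notation config := (config n m).
Local Notation nu := (@noise_pmf R n m eps).
Local Notation step := (@nvm_step n m).
Local Notation K := (trans nu step).
Local Notation spin := (@spin R n m).
Local Notation inN := (@inl 'I_n 'I_m).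
Local Notation inM := (@inr 'I_n 'I_m).
Local Notation A := (part_mean R inN).
Local Notation B := (part_mean R inM).
Local Notation q := (1 - eps).
Local Notation x := ((1 - eps) ^+ 2).
Local Notation al := (n%:R^-1 : R).
Local Notation be := (m%:R^-1 : R).
Local Notation pi := (stat nu step [ffun=> false]).

Let nu_ge0 : forall s, 0 <= nu s := @noise_pmf_ge0 R n m eps eps01.
Let nu_sum1 : \sum_s nu s = 1 := @noise_pmf_sum1 R n m eps n_gt0 m_gt0.
Let reset_step := @refresh_step n m.
Let reset_pos := @refresh_pos R n m eps n_gt0 m_gt0 eps01.

Let sD f g : pi (f \+ g) = pi f + pi g := @statD _ _ _ nu_ge0 nu_sum1 _ _ _ reset_step reset_pos _ f g.
Let sZ c f : pi (fun z => c * f z) = c * pi f := @statZ _ _ _ nu_ge0 nu_sum1 _ _ _ reset_step reset_pos _ c f.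
Let sC c : pi (fun=> c) = c := @stat_cst _ _ _ nu_sum1 _ _ _ c.
Let sK f : pi (K f) = pi f := @stat_trans _ _ _ nu_ge0 nu_sum1 _ _ _ reset_step reset_pos _ f.

Lemma trans_B z : K B z = q * A z.
Proof. exact: trans_part_mean. Qed.

Lemma trans_spinN u z : K (fun z' => spin z' (inl u)) z = q * B z.
Proof. exact: (trans_spin1 n_gt0 m_gt0 (f := inN)). Qed.

Lemma trans_A2 z : K (fun z => A z ^+ 2) z = al + (1 - al) * (x * B z ^+ 2).
Proof.
rewrite -exprMn; apply: trans_part_mean2 => //; exact: inl_inj.
Qed.

Lemma trans_B2 z : K (fun z => B z ^+ 2) z = be + (1 - be) * (x * A z ^+ 2).
Proof.
rewrite -exprMn; apply: trans_part_mean2 => //; exact: inr_inj.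
Qed.

Lemma trans_A3 z : K (fun z => A z ^+ 3) z =
  q * B z * (al * (3 - 2 * al) + (1 - al) * (1 - 2 * al) * (x * B z ^+ 2)).
Proof.
rewrite -[x * _]exprMn; apply: trans_part_mean3 => //; exact: inl_inj.
Qed.

Lemma trans_B3 z : K (fun z => B z ^+ 3) z =
  q * A z * (be * (3 - 2 * be) + (1 - be) * (1 - 2 * be) * (x * A z ^+ 2)).
Proof.
rewrite -[x * _]exprMn; apply: trans_part_mean3 => //; exact: inr_inj.
Qed.

Lemma trans_spinN_A p u z :
  K (fun z => spin z (inl u) * A z ^+ p) z = K (fun z => A z ^+ p.+1) z.
Proof. apply: trans_spin_mean => //; exact: inl_inj. Qed.

Definition pair_decay : R := x ^+ 2 * (1 - al) * (1 - be).
Definition second_moment : R := pi (fun z => A z ^+ 2).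
Local Notation p := second_moment.
Local Notation c := (al + (1 - al) * x * be).

(** Invariance of the stationary mean, applied to the squares of [A] and [B], gives two linear
    equations that close up. *)
Lemma second_momentE : p = c + pair_decay * p.
Proof.
have pB : pi (fun z => B z ^+ 2) = be + (1 - be) * (x * p).
  rewrite -sK (stat_ext _ _ _ trans_B2) (sD (fun=> be) (fun z => (1 - be) * (x * A z ^+ 2))).
  by rewrite sC !sZ.
rewrite {1}/p -sK (stat_ext _ _ _ trans_A2) (sD (fun=> al) (fun z => (1 - al) * (x * B z ^+ 2))).
by rewrite sC !sZ pB /pair_decay; ring.
Qed.

Lemma trans2_spinN u z : K (K (fun z => spin z (inl u))) z = x * A z.
Proof. by rewrite (trans_ext _ _ (trans_spinN u)) transZ trans_B; ring. Qed.

Lemma trans2_A2 z : K (K (fun z => A z ^+ 2)) z = c + pair_decay * A z ^+ 2.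
Proof.
rewrite (trans_ext _ _ trans_A2) (transD nu step (fun=> al) (fun z => (1 - al) * (x * B z ^+ 2))) /=.
by rewrite trans_cst // !transZ trans_B2 /pair_decay; ring.
Qed.

Lemma stat_spinN_A u : pi (fun z => spin z (inl u) * A z) = p.
Proof.
rewrite -sK -[p]sK; apply: stat_ext => z; rewrite -(trans_spinN_A 1 u).
by apply: trans_ext => z'; rewrite expr1.
Qed.

Lemma stat_spinN_A3 u : pi (fun z => spin z (inl u) * A z ^+ 3) = pi (fun z => A z ^+ 4).
Proof. by rewrite -sK -[RHS]sK; apply: stat_ext => z; exact: trans_spinN_A. Qed.

(** Up to a factor [x], [cube_coef1] and [cube_coef3] are the coefficients of A and A^3 in the
    two-step mean of A^3; see [trans2_A3]. *)
Definition cube_coef1 : R := al * (3 - 2 * al) + (1 - al) * (1 - 2 * al) * x * (be * (3 - 2 * be)).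
Definition cube_coef3 : R := (1 - al) * (1 - 2 * al) * (1 - be) * (1 - 2 * be) * x ^+ 2.

Lemma trans2_A3 z : K (K (fun z => A z ^+ 3)) z = x * (cube_coef1 * A z + cube_coef3 * A z ^+ 3).
Proof.
rewrite (@trans_ext _ _ _ _ _ _ ((fun z => q * (al * (3 - 2 * al)) * B z) \+
   (fun z => q ^+ 3 * ((1 - al) * (1 - 2 * al)) * B z ^+ 3))); last first.
  by move=> z'; rewrite trans_A3 /=; ring.
rewrite transD /= (transZ _ _ (q * (al * (3 - 2 * al))) B) trans_B.
rewrite (transZ _ _ (q ^+ 3 * _) (fun z => B z ^+ 3)) trans_B3 /cube_coef1 /cube_coef3; ring.
Qed.


Lemma pair_decay_lt1 : pair_decay < 1.
Proof.
have [/andP[a0 a1] /andP[b0 b1] /andP[x0 x1]] := And3 (inv_nat_bounds R n_gt0) (inv_nat_bounds R m_gt0) (retention_bounds eps01).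
rewrite /pair_decay -mulrA; apply: (@le_lt_trans _ _ (x ^+ 2 * 1)).
  rewrite ler_wpM2l ?sqr_ge0 //; apply: mulr_ile1; lra.
by rewrite mulr1 expr_lt1 ?ltW.
Qed.

Lemma second_moment_closed : p = c / (1 - pair_decay).
Proof.
have l1 : 1 - pair_decay != 0 by rewrite subr_eq0 eq_sym lt_eqF ?pair_decay_lt1.
by apply: (mulIf l1); rewrite divfK // mulrBr mulr1 {1}second_momentE; ring.
Qed.

Lemma second_moment_gt0 : 0 < p.
Proof.
have [/andP[a0 a1] /andP[b0 b1] /andP[x0 x1]] := And3 (inv_nat_bounds R n_gt0) (inv_nat_bounds R m_gt0) (retention_bounds eps01).
rewrite second_moment_closed divr_gt0 ?subr_gt0 ?pair_decay_lt1 //.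
apply: ltr_pwDl => //; apply: mulr_ge0; last exact: ltW.
by apply: mulr_ge0; [rewrite subr_ge0 | exact: sqr_ge0].
Qed.

Lemma second_moment_le1 : p <= 1.
Proof.
have [/andP[a0 a1] /andP[b0 b1] /andP[x0 x1]] := And3 (inv_nat_bounds R n_gt0) (inv_nat_bounds R m_gt0) (retention_bounds eps01).
rewrite second_moment_closed ler_pdivrMr ?subr_gt0 ?pair_decay_lt1 // mul1r -subr_ge0 /pair_decay.
set X := x in x0 x1 *.
have -> : 1 - X ^+ 2 * (1 - al) * (1 - be) - c = (1 - al) * ((1 - X) * be + (1 - X ^+ 2) * (1 - be)) by rewrite /X; ring.
rewrite mulr_ge0 ?subr_ge0 // addr_ge0 // mulr_ge0 ?subr_ge0 ?(ltW x1) ?(ltW b0) //.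
by rewrite expr_le1 // ltW.
Qed.

(** The stationary covariance of s_0 s_2 with the square of the mean spin [A] at time 2: these have
    means [x * p] and [p]. It is the V of the overview. *)
Definition fourth_cov u : R :=
  pi (fun z => spin z (inl u) * K (K (fun z => spin z (inl u) * A z ^+ 2)) z) - x * p ^+ 2.

Lemma fourth_covE u : fourth_cov u = x * (cube_coef1 * p + cube_coef3 * pi (fun z => A z ^+ 4) - p ^+ 2).
Proof.
rewrite /fourth_cov (@stat_ext _ _ _ _ _ _ _
   ((fun z => x * cube_coef1 * (spin z (inl u) * A z)) \+ (fun z => x * cube_coef3 * (spin z (inl u) * A z ^+ 3)))); last first.
  move=> z; rewrite (trans_ext _ _ (trans_spinN_A 2 u)) trans2_A3 /=; ring.
by rewrite sD !sZ stat_spinN_A stat_spinN_A3; ring.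
Qed.

(** The fourth moment is at least [p ^+ 2] and [cube_coef3 >= 0], so it suffices that
    [cube_coef1 - p + cube_coef3 * p > 0]. By [second_momentE], [p <= 1] and
    [cube_coef3 <= pair_decay], this follows from the factorization [key]. *)
Lemma fourth_cov_gt0 u : (1 < n)%N -> (1 < m)%N -> 0 < fourth_cov u.
Proof.
move=> n1 m1.
have half k : (1 < k)%N -> 0 <= 1 - 2 * (k%:R^-1 : R).
  move=> k1; rewrite subr_ge0 -ler_pdivlMl ?ltr0n // mulr1 lef_pV2 ?posrE ?ltr0n 1?ltnW //.
  by rewrite ler_nat.
have [/andP[a0 a1] /andP[b0 b1] /andP[x0 x1]] := And3 (inv_nat_bounds R n_gt0) (inv_nat_bounds R m_gt0) (retention_bounds eps01).
have a2 := half _ n1; have b2 := half _ m1.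
have p0 := second_moment_gt0; have p1 := second_moment_le1.
have c3_ge0 : 0 <= cube_coef3 by rewrite /cube_coef3; nonneg.
have F : p ^+ 2 <= pi (fun z => A z ^+ 4).
  rewrite /p (@stat_ext _ _ _ _ _ _ (fun z => A z ^+ 4) (fun z => (A z ^+ 2) ^+ 2)).
    exact: (stat_sqr nu_ge0 nu_sum1 reset_step reset_pos).
  by move=> z; rewrite -exprM.
have c3_le : cube_coef3 <= pair_decay.
  rewrite /cube_coef3 /pair_decay -subr_ge0.
  have -> : x ^+ 2 * (1 - al) * (1 - be) - (1 - al) * (1 - 2 * al) * (1 - be) * (1 - 2 * be) * x ^+ 2
    = x ^+ 2 * (1 - al) * (1 - be) * (2 * al + 2 * be * (1 - 2 * al)) by ring.
  by nonneg.
have key : cube_coef1 - c - (pair_decay - cube_coef3) = (1 - al) * (1 - x) * (2 * al + x * (1 - be) * (2 * al + 2 * be * (1 - 2 * al))).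
  by rewrite /cube_coef1 /cube_coef3 /pair_decay; ring.
have al1 : al < 1 by rewrite invf_lt1 ?ltr0n // ltr1n.
have key_gt0 : 0 < cube_coef1 - c - (pair_decay - cube_coef3).
  rewrite key !mulr_gt0 ?subr_gt0 // ltr_pwDl ?mulr_gt0 //.
  by nonneg.
rewrite fourth_covE; apply: mulr_gt0 => //.
apply: (@lt_le_trans _ _ (p * (cube_coef1 - p + cube_coef3 * p))); last first.
  have := ler_wpM2l c3_ge0 F; set F4 := pi _; lra.
apply: mulr_gt0 => //; apply: (lt_le_trans key_gt0).
have := ler_wpM2l (_ : 0 <= pair_decay - cube_coef3) p1; rewrite subr_ge0 => /(_ c3_le).
by have := second_momentE; lra.
Qed.

Variable u : 'I_n.

Definition sign_of_nat (k : nat) : R := k%:R *+ 2 - 1.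

Fixpoint lag_product (gs : seq nat) (h : nat -> nat) : R :=
  sign_of_nat (h 0%N) *
  if gs is g :: gs' then lag_product gs' (fun b => h (g + b)%N) else 1.

(** Here [gs] lists the gaps between consecutive factors: [[:: 2; 2; 2]] stands for s_0 s_2 s_4 s_6
    and [[:: 2; 4; 2]] for s_0 s_2 s_6 s_8. *)
Fixpoint lag_mean (gs : seq nat) (z : config) : R :=
  spin z (inl u) * if gs is g :: gs' then iter g K (lag_mean gs') z else 1.

Definition obs_window (phi : (nat -> nat) -> R) (z : config) (l : seq noise) : R :=
  phi (fun b => run step z (take b l) (inl u) : nat).

(** The Markov property at the end of each gap. *)
Lemma lag_window_mean gs z :
  window_mean nu (sumn gs) (obs_window (lag_product gs)) z = lag_mean gs z.
Proof.
have sgn (z' : config) : sign_of_nat (z' (inl u)) = spin z' (inl u).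
  by rewrite /sign_of_nat /spin; case: (z' _); rewrite /=; ring.
elim: gs z => [|g gs IH] z; rewrite /window_mean.
  by rewrite /= /obs_window /= sgn.
rewrite /= expect_seq_cat -expect_run -expect_seqZ; apply: expect_seq_ext => l1 s1.
rewrite -IH -expect_seqZ; apply: expect_seq_ext => l2 _.
rewrite /obs_window /= take0 /= sgn; congr (_ * lag_product _ _).
by apply/funext => b; rewrite takeD take_size_cat // drop_size_cat // run_cat.
Qed.

Lemma lag_mean2 z : lag_mean [:: 2]%N z = x * (spin z (inl u) * A z).
Proof.
rewrite /= (trans_ext _ _ (trans_ext _ _ (fun z => mulr1 _))) trans2_spinN; ring.
Qed.

Lemma trans2_lag_mean2 z : K (K (lag_mean [:: 2]%N)) z = x * (c + pair_decay * A z ^+ 2).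
Proof.
rewrite (trans_ext _ _ (trans_ext _ _ lag_mean2)) -trans2_A2 -transZ; apply: trans_ext => z'.
rewrite transZ; congr (_ * _); rewrite -(trans_spinN_A 1 u).
by apply: trans_ext => z''; rewrite expr1.
Qed.

Lemma stat_lag2 : pi (lag_mean [:: 2]%N) = x * p.
Proof. by rewrite (stat_ext _ _ _ lag_mean2) sZ stat_spinN_A. Qed.

(** The common end of both four-spin correlations. Seen from the second time, the last pair has mean
    [x] times d + e A^2, where (d, e) is (c, l) after a gap of 2 and (c + l c, l^2) after a gap of
    4, with l = [pair_decay]. *)
Lemma stat_lag_aux d e : pi (fun z => spin z (inl u) *
    K (K (fun z => spin z (inl u) * (x * (d + e * A z ^+ 2)))) z) =
  x * (d * (x * p) + e * (fourth_cov u + x * p ^+ 2)).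
Proof.
rewrite (@stat_ext _ _ _ _ _ _ _ ((fun z => x * d * x * (spin z (inl u) * A z)) \+
  (fun z => x * e * (spin z (inl u) * K (K (fun z => spin z (inl u) * A z ^+ 2)) z)))); last first.
  move=> z.
  have h z' : spin z' (inl u) * (x * (d + e * A z' ^+ 2)) =
     ((fun z => x * d * spin z (inl u)) \+ (fun z => x * e * (spin z (inl u) * A z ^+ 2))) z'.
    by rewrite /=; ring.
  rewrite (trans_ext _ _ (trans_ext _ _ h)) (trans_ext _ _ (transD _ _ _ _)) transD /=.
  rewrite (trans_ext _ _ (transZ _ _ _ _)) transZ trans2_spinN.
  rewrite (trans_ext _ _ (transZ _ _ _ _)) transZ; ring.
by rewrite sD !sZ stat_spinN_A /fourth_cov; ring.
Qed.

Lemma stat_lag222 : pi (lag_mean [:: 2; 2; 2]%N) = x * (x * p ^+ 2 + pair_decay * fourth_cov u).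
Proof.
transitivity (x * (c * (x * p) + pair_decay * (fourth_cov u + x * p ^+ 2))); last first.
  (* With c = (1 - l) p the terms without [fourth_cov] add up to [x * p ^+ 2]. *)
  have -> : c = p - pair_decay * p by rewrite {1}second_momentE addrK.
  by ring.
rewrite -stat_lag_aux; apply: stat_ext => z; rewrite /=; congr (_ * _).
do 2![apply: trans_ext => ?]; congr (_ * _); exact: trans2_lag_mean2.
Qed.

Lemma stat_lag242 : pi (lag_mean [:: 2; 4; 2]%N) = x * (x * p ^+ 2 + pair_decay ^+ 2 * fourth_cov u).
Proof.
transitivity (x * ((c + pair_decay * c) * (x * p) + pair_decay ^+ 2 * (fourth_cov u + x * p ^+ 2))); last first.
  have -> : c = p - pair_decay * p by rewrite {1}second_momentE addrK.
  by ring.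
rewrite -stat_lag_aux; apply: stat_ext => z; rewrite /=; congr (_ * _).
do 2![apply: trans_ext => ?]; congr (_ * _).
rewrite (trans_ext _ _ (trans_ext _ _ trans2_lag_mean2)).
have h z' : x * (c + pair_decay * A z' ^+ 2) = ((fun=> x * c) \+ (fun z => x * pair_decay * A z ^+ 2)) z'.
  by rewrite /=; ring.
rewrite (trans_ext _ _ (trans_ext _ _ h)) (trans_ext _ _ (transD _ _ _ _)) transD /=.
rewrite (trans_ext _ _ (trans_cst _ _ _)) // trans_cst //.
rewrite (trans_ext _ _ (transZ _ _ _ _)) transZ trans2_A2; ring.
Qed.

End StationaryMoments.

(** * Laws of large numbers and distinguishability *)

(** The normalization is that of [repetition], with value 0 for [t <= D]. The functional [phi] takes
    a whole sequence, so that windows carry no length in their type. *)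
Definition window_stat (R : realType) (D : nat) (phi : (nat -> nat) -> R) :
  statistic R := fun t x =>
  ((t - D)%N%:R)^-1 *
  \sum_(1 <= i < (t - D).+1) phi (fun b => nth 0%N x (i + b)%N).

Section Concentration.
Variables (R : realType) (n m : nat) (eps : R).
Hypotheses (n_gt0 : (0 < n)%N) (m_gt0 : (0 < m)%N) (eps01 : 0 < eps < 1).
Variables (dsp : measure_display) (Omega : measurableType dsp).
Variables (P : probability Omega R) (N : nvm P (complete_bipartite n m) eps).
Variable u : 'I_n.

Local Notation nu := (@noise_pmf R n m eps).
Local Notation step := (@nvm_step n m).

Variables (D : nat) (phi : (nat -> nat) -> R).
Hypothesis phi_local :
  forall h h', (forall b, (b <= D)%N -> h b = h' b) -> phi h = phi h'.
Hypothesis phi_bound : forall h, (forall b, (h b <= 1)%N) -> `|phi h| <= 1.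

(** The starting configuration is an arbitrary choice: by [stat_rate] the iterates have the same
    limit from any other. *)
Definition limit_mean : R :=
  stat nu step [ffun=> false] (window_mean nu D (@obs_window R n m u phi)).

Local Notation L := limit_mean.

Lemma window_statE k w :
  window_stat D phi (observations N (inl u) (k.+1 + D) w) =
  (k.+1%:R)^-1 * \sum_(1 <= i < k.+2)
    @obs_window R n m u phi (run step (init_at N w) (take i (history N (k.+1 + D) w)))
      (drop i (history N (k.+1 + D) w)).
Proof.
rewrite /window_stat addnK; congr (_ * _); apply: eq_big_nat => i /andP[_ ik].
apply: phi_local => b bD; have it : (i + b < (k.+1 + D).+1)%N by lia.
rewrite -run_cat -takeD take_history // -nvm_stateE //.
have -> : (i + b)%N = Ordinal it by [].
by rewrite -tnth_nth tnth_mktuple.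
Qed.

(** [window_chebyshev] holds for every initial configuration with one constant, so it survives
    averaging over the initial law. The time [k.+1 + D] leaves exactly [k.+1] windows. *)
Lemma window_stat_concentration : exists C : R, forall delta, 0 < delta -> forall k,
  let E := [set w | delta <=
    `|window_stat D phi (observations N (inl u) (k.+1 + D) w) - L|] in
  measurable E /\ (P E <= (C / delta ^+ 2 / k.+1%:R)%:E)%E.
Proof.
have nu0 := @noise_pmf_ge0 R n m eps eps01.
have nu1 := @noise_pmf_sum1 R n m eps n_gt0 m_gt0.
have rs := @refresh_step n m.
have rp := @refresh_pos R n m eps n_gt0 m_gt0 eps01.
exists (variance_bound nu (@refresh n m) D (@obs_window R n m u phi)) => delta d0 k E.
pose Q z l := delta <= `|(k.+1%:R)^-1 * (\sum_(1 <= i < k.+2)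
    @obs_window R n m u phi (run step z (take i l)) (drop i l)) - L|.
have -> : E = [set w | Q (init_at N w) (history N (k.+1 + D) w)].
  by apply/seteqP; split=> w /=; rewrite /E /= window_statE.
have [mE ->] := prob_history N eps01 Q (k.+1 + D).
split=> //; rewrite lee_fin; set C := _ / _ / _.
have -> : C = \sum_(z : config n m) init_pmf R z * C.
  by rewrite -mulr_suml init_pmf_sum1 mul1r.
apply: ler_sum => z _; rewrite ler_wpM2l ?init_pmf_ge0 //.
have pl z' l : @obs_window R n m u phi z' (take D l) = obs_window u phi z' l.
  by apply: phi_local => b bD; rewrite take_takel.
have pb z' l : `|@obs_window R n m u phi z' l| <= 1.
  by apply: phi_bound => b; exact: leq_b1.
exact: (@window_chebyshev _ _ _ nu0 nu1 _ _ _ rs rp [ffun=> false] D _ pl pb z k delta d0).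
Qed.

End Concentration.

(** The sets are balls around the two limits with radius half their distance. Failure is the union
    of two deviation events of vanishing probability, so a union bound covers any coupling of [N1]
    and [N2]. *)
Lemma distinguishable_window (R : realType) (n1 m1 n2 m2 : nat) (eps : R)
    (dsp : measure_display) (Omega : measurableType dsp)
    (P : probability Omega R)
    (N1 : nvm P (complete_bipartite n1 m1) eps)
    (N2 : nvm P (complete_bipartite n2 m2) eps)
    (u1 : 'I_n1) (u2 : 'I_n2) (D : nat) (phi : (nat -> nat) -> R) :
  (0 < m1)%N -> (0 < m2)%N -> 0 < eps < 1 ->
  (forall h h', (forall b, (b <= D)%N -> h b = h' b) -> phi h = phi h') ->
  (forall h, (forall b, (h b <= 1)%N) -> `|phi h| <= 1) ->
  limit_mean m1 eps u1 D phi != limit_mean m2 eps u2 D phi ->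
  distinguishable_by N1 (inl u1) N2 (inl u2) (window_stat D phi).
Proof.
move=> m1_gt0 m2_gt0 eps01 phi_loc phi_bd; set L1 := limit_mean _ _ _ _ _; set L2 := limit_mean _ _ _ _ _.
move=> L12; pose delta := `|L1 - L2| / 2.
have d0 : 0 < delta by rewrite divr_gt0 // normr_gt0 subr_eq0.
have [C1 h1] := window_stat_concentration (leq_ltn_trans (leq0n _) (ltn_ord u1)) m1_gt0 eps01 N1 u1 phi_loc phi_bd.
have [C2 h2] := window_stat_concentration (leq_ltn_trans (leq0n _) (ltn_ord u2)) m2_gt0 eps01 N2 u2 phi_loc phi_bd.
exists (fun=> [set y | `|y - L1| < delta]), (fun=> [set y | `|y - L2| < delta]); split.
  move=> _; rewrite -subset0 => y /= [y1 y2].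
  have : `|L1 - L2| < `|L1 - L2|.
    rewrite {2}(_ : `|L1 - L2| = delta + delta); last by rewrite /delta; field.
    apply: le_lt_trans (ltrD y1 y2); rewrite -[in leRHS](distrC L1).
    exact: ler_distD.
  by rewrite ltxx.
set F := (fun t : nat => P _).
(* After this shift the index [k] corresponds to the time [k.+1 + D]. *)
rewrite -(cvg_shiftn D.+1) /=.
pose G k : \bar R := (1 - (C1 / delta ^+ 2 + C2 / delta ^+ 2) / k.+1%:R)%:E.
have hG k : (G k <= F (k + D.+1)%N <= 1)%E.
  have -> : (k + D.+1 = k.+1 + D)%N by lia.
  have [mE1 p1] := h1 _ d0 k; have [mE2 p2] := h2 _ d0 k.
  rewrite /F; set E1 := [set w | delta <= _] in mE1 p1; set E2 := [set w | delta <= _] in mE2 p2.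
  set H := [set w | _ /\ _]; have -> : H = ~` (E1 `|` E2).
    apply/seteqP; split=> w /=.
      by move=> [a b] [|]; rewrite /E1 /E2 /= leNgt ?a ?b.
    move=> /not_orP[a b]; split; rewrite /= ltNge; apply/negP; [exact: a | exact: b].
  have mE : measurable (E1 `|` E2) by exact: measurableU.
  apply/andP; split; last by apply: probability_le1; exact: measurableC.
  rewrite probability_setC //.
  rewrite /G EFinB leeB //; apply: le_trans (measureU2 _ mE1 mE2) _.
  by rewrite mulrDl EFinD leeD.
have hGc : G k @[k --> \oo] --> 1%E.
  rewrite /G; apply: cvg_EFin; first by near=> k.
  rewrite -[X in _ --> X]subr0; apply: cvgB; first exact: cvg_cst.
  rewrite -[X in _ --> X](mulr0 (C1 / delta ^+ 2 + C2 / delta ^+ 2)).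
  by apply: cvgM; [exact: cvg_cst | exact: cvg_harmonic].
have near_hG : \forall k \near \oo, (G k <= F (k + D.+1)%N <= 1)%E by near=> k; exact: hG.
exact: (squeeze_cvge near_hG hGc (cvg_cst _)).
Unshelve. all: end_near. Qed.

(** * Coalescing walks *)

Section Walks.
Variables (n m : nat).
Local Notation V := ('I_n + 'I_m)%type.
Local Notation noise := (noise n m).

(* Noise lists are read backwards in time here: the head is the latest step. *)
Fixpoint walk_meet (l : seq noise) (v w : V) : bool :=
  (v == w) || if l is s :: l' then
    [&& ~~ (s v).1.1, ~~ (s w).1.1 & walk_meet l' (s v).2 (s w).2] else false.

(** The walker from the later time moves alone through the [d] latest noises; only then can the two
    paths share a vertex. *)
Fixpoint lag_meet (d : nat) (l : seq noise) (v w : V) : bool :=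
  if d is d'.+1 then
    if l is s :: l' then ~~ (s w).1.1 && lag_meet d' l' v (s w).2 else false
  else walk_meet l v w.

Section Paths.
Variables (R : realType) (eps : R) (dsp : measure_display) (Omega : measurableType dsp).
Variables (P : probability Omega R) (N : nvm P (complete_bipartite n m) eps).
Variable w : Omega.

Fixpoint dipath (t : nat) (v : V) : seq (V * nat) :=
  if t is t'.+1 then
    if xi N t v w then [::] else (Defs.eta N t v w, t') :: dipath t' (Defs.eta N t v w)
  else [::].

Lemma path_dipath t v : path (dg_edge N w) (v, t) (dipath t v).
Proof.
elim: t v => //= t IH v; case: ifP => //= h.
by rewrite IH andbT /dg_edge /= eqxx h eqxx.
Qed.

(** A space-time vertex has at most one outgoing edge, so all paths from it are prefixes of a single
    one, and the longest is unique. *)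
Lemma dipath_prefix t v q :
  path (dg_edge N w) (v, t) q -> q = take (size q) (dipath t v).
Proof.
elim: q t v => [|[v' t'] q IH] t v /=; first by rewrite take0.
move=> /andP[/and3P[/= /eqP -> xi0 /eqP <-]] /IH {1}->.
by rewrite /= (negbTE xi0).
Qed.

Lemma longest_dipathE t v p : longest_dipath N w (v, t) p <-> p = dipath t v.
Proof.
split=> [[pp pl]|->].
  rewrite {1}(dipath_prefix pp) take_oversize //.
  exact/pl/path_dipath.
split=> [|q /dipath_prefix ->]; first exact: path_dipath.
by rewrite size_take_min geq_minr.
Qed.

Lemma dipath_time t v y : y \in dipath t v -> (y.2 < t)%N.
Proof.
elim: t v => //= t IH v; case: ifP => // _; rewrite inE => /orP[/eqP -> //|/IH].
by move=> h; apply: ltn_trans h _.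
Qed.

Let rhist t := rev (history N t w).

Lemma rhistS t : rhist t.+1 = noise_at N t.+1 w :: rhist t.
Proof. by rewrite /rhist history_rcons rev_rcons. Qed.

(** Time drops by one along each edge, so a common vertex is reached by both walkers after the same
    number of steps. *)
Lemma share_dipath t v v' :
  (exists y, y \in (v, t) :: dipath t v /\ y \in (v', t) :: dipath t v') <->
  walk_meet (rhist t) v v'.
Proof.
elim: t v v' => [|t IH] v v'.
  rewrite /rhist (size0nil (size_tuple (history N 0 w))) /= orbF.
  split=> [[y []]|/eqP <-]; first by rewrite !inE => /eqP -> /eqP [->].
  by exists (v, 0%N); rewrite inE eqxx.
rewrite rhistS /= !ffunE /=; split.
  move=> [y []]; rewrite inE => /orP[/eqP ->|yv]; rewrite inE => /orP[/eqP|yv'].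
  - by move=> [->]; rewrite eqxx.
  - by have := @dipath_time t.+1 v' _ yv'; rewrite ltnn.
  - by move=> ye; have := @dipath_time t.+1 v _ yv; rewrite ye ltnn.
  - move: yv yv'; case: (xi N t.+1 v w) => //; case: (xi N t.+1 v' w) => // yv yv'.
    by apply/orP; right; apply/IH; exists y.
move=> /orP[/eqP <-|]; first by exists (v, t.+1); rewrite inE eqxx.
case/and3P => /negbTE -> /negbTE -> /IH[y [yv yv']].
by exists y; rewrite [y \in _ :: _ :: _]inE yv orbT inE yv' orbT.
Qed.

Lemma share_dipath_lag d t v v' :
  (exists y, y \in (v, t) :: dipath t v /\ y \in (v', (t + d)%N) :: dipath (t + d) v') <->
  lag_meet d (rhist (t + d)) v v'.
Proof.
elim: d v' => [|d IH] v'; first by rewrite addn0; exact: share_dipath.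
rewrite addnS rhistS /= !ffunE /=; split.
  move=> [y [yv]]; rewrite inE => /orP[/eqP ye|].
    have : (y.2 <= t)%N.
      by move: yv; rewrite inE => /orP[/eqP -> //|/dipath_time/ltnW].
    by rewrite ye /=; lia.
  by case: (xi N (t + d).+1 v' w) => // yv'; apply/IH; exists y.
case/andP => /negbTE -> /IH[y [yv yv']].
by exists y; rewrite yv inE yv' orbT.
Qed.

Lemma paths_meetE u d t : paths_meet N u d t w <-> lag_meet d (rhist (t + d)) u u.
Proof.
rewrite -share_dipath_lag; split.
  by move=> [p [q [/longest_dipathE -> /longest_dipathE -> h]]].
move=> h; exists (dipath t u), (dipath (t + d) u).
by split; [exact/longest_dipathE|exact/longest_dipathE|].
Qed.

End Paths.

(** * Meeting probabilities of two walkers *)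

Section MeetingProbability.
Variables (R : realType) (eps : R).
Hypotheses (n_gt0 : (0 < n)%N) (m_gt0 : (0 < m)%N) (eps01 : 0 < eps < 1).

Local Notation nu := (@noise_pmf R n m eps).
Local Notation EN := (expect_seq nu).
Local Notation site := (@site_pmf R n m eps).
Local Notation q := (1 - eps).
Local Notation x := ((1 - eps) ^+ 2).
Local Notation al := (n%:R^-1 : R).
Local Notation be := (m%:R^-1 : R).
Local Notation nmean := (@nbr_mean R n m).

Definition meet_prob k v w : R := EN k (fun l => (walk_meet l v w)%:R).
Definition lag_meet_prob d k v w : R := EN (k + d) (fun l => (lag_meet d l v w)%:R).

Let nu_sum1 : \sum_s nu s = 1 := @noise_pmf_sum1 R n m eps n_gt0 m_gt0.

Lemma meet_prob_refl k v : meet_prob k v v = 1.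
Proof.
rewrite -[RHS](expect_seq_cst nu_sum1 k); apply: expect_seq_ext => l _.
by case: l => [|s l] /=; rewrite eqxx.
Qed.

Lemma meet_prob0 v w : meet_prob 0 v w = (v == w)%:R.
Proof. by rewrite /meet_prob /= orbF. Qed.

Lemma alive_sum v (g : V -> R) :
  \sum_y site v y * ((~~ y.1.1)%:R * g y.2) = q * nmean v g.
Proof.
rewrite site_sum /=; have -> : nmean v (fun w => true%:R * g w) = nmean v g.
  by congr (nmean v _); apply/funext => w; rewrite mul1r.
have -> : nmean v (fun w => false%:R * g w) = 0.
  rewrite -[RHS](nbr_mean_cst n_gt0 m_gt0 v 0); congr (nmean v _).
  by apply/funext => w; rewrite mul0r.
by field.
Qed.

(** Walkers at distinct sites use independent letters, and each moves on with probability
    [1 - eps]. *)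
Lemma meet_probS k v w : v != w ->
  meet_prob k.+1 v w = x * nmean v (fun v' => nmean w (meet_prob k v')).
Proof.
move=> vw; rewrite /meet_prob /=.
transitivity (\sum_s nu s * ((~~ (s v).1.1)%:R * ((~~ (s w).1.1)%:R * meet_prob k (s v).2 (s w).2))).
  apply: eq_bigr => s _; congr (_ * _); rewrite /meet_prob -!expect_seqZ.
  by apply: expect_seq_ext => l _; rewrite (negbTE vw) /= -!mulnb !natrM.
rewrite (noise_marginal2 eps n_gt0 m_gt0
  (fun y y' => (~~ y.1.1)%:R * ((~~ y'.1.1)%:R * meet_prob k y.2 y'.2)) vw).
transitivity (\sum_y site v y * ((~~ y.1.1)%:R * (q * nmean w (meet_prob k y.2)))).
  apply: eq_bigr => y _; rewrite -alive_sum !mulr_sumr; apply: eq_bigr => y' _.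
  by ring.
rewrite (alive_sum v (fun v' => q * nmean w (meet_prob k v'))) expr2 -mulrA; congr (_ * _).
by case: v {vw} => i /=; rewrite -mulr_sumr mulrCA.
Qed.

Lemma lag_meet_probS d k v w :
  lag_meet_prob d.+1 k v w = q * nmean w (lag_meet_prob d k v).
Proof.
rewrite -alive_sum /lag_meet_prob addnS /=.
rewrite -(noise_marginal eps n_gt0 m_gt0 w (fun y => (~~ y.1.1)%:R *
  EN (k + d) (fun l => (lag_meet d l v y.2)%:R))).
apply: eq_bigr => s _; congr (_ * _); rewrite -expect_seqZ.
by apply: expect_seq_ext => l _; rewrite -mulnb natrM.
Qed.

(** The meeting probability of a fixed walker and a uniform one in the same part, for the left part
    and then for the right one. The recursion is that of the second moments of A and B. *)
Fixpoint mean_meet (k : nat) : R * R :=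
  if k is k'.+1 then
    (al + (1 - al) * x * (mean_meet k').2, be + (1 - be) * x * (mean_meet k').1)
  else (al, be).

(** The walkers start together with probability 1/n or 1/m. Otherwise both survive a step with
    probability [x] and are then independent and uniform in the other part. The ordinals 0 only
    select the part over which [nmean] averages. *)
Lemma mean_meetE k :
  (forall i, nmean (inr (Ordinal m_gt0)) (meet_prob k (inl i)) = (mean_meet k).1) /\
  (forall j, nmean (inl (Ordinal n_gt0)) (meet_prob k (inr j)) = (mean_meet k).2).
Proof.
have delta (p : nat) (i : 'I_p) (c : R) : (0 < p)%N ->
   p%:R^-1 * \sum_(j < p) (if i == j then 1 else c) = p%:R^-1 + (1 - p%:R^-1) * c.
  move=> p0; rewrite (bigD1 i) //= eqxx (eq_bigr (fun=> c)); last first.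
    by move=> j /negbTE; rewrite eq_sym => ->.
  have -> : \sum_(j < p | j != i) c = p%:R * c - c.
    have : \sum_(j < p) c = p%:R * c by rewrite sumr_const card_ord mulr_natl.
    by rewrite (bigD1 i) //= => <-; rewrite addrAC subrr add0r.
  by field; rewrite pnatr_eq0 -lt0n.
elim: k => [|k [IH1 IH2]]; split=> i /=.
- rewrite (eq_bigr (fun j => if i == j then 1 else 0)) ?delta ?mulr0 ?addr0 // => j _.
  by rewrite meet_prob0 (inj_eq (@inl_inj _ _)); case: eqP.
- rewrite (eq_bigr (fun j => if i == j then 1 else 0)) ?delta ?mulr0 ?addr0 // => j _.
  by rewrite meet_prob0 (inj_eq (@inr_inj _ _)); case: eqP.
- rewrite (eq_bigr (fun j => if i == j then 1 else x * (mean_meet k).2)) ?delta ?mulrA // => j _.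
  case: eqP => [->|/eqP ij]; first exact: meet_prob_refl.
  rewrite meet_probS ?(inj_eq (@inl_inj _ _)) //; congr (_ * _).
  rewrite -[RHS](nbr_mean_cst n_gt0 m_gt0 (inl i) _); congr (_ * _).
  by apply: eq_bigr => v _; exact: IH2.
- rewrite (eq_bigr (fun j => if i == j then 1 else x * (mean_meet k).1)) ?delta ?mulrA // => j _.
  case: eqP => [->|/eqP ij]; first exact: meet_prob_refl.
  rewrite meet_probS ?(inj_eq (@inr_inj _ _)) //; congr (_ * _).
  rewrite -[RHS](nbr_mean_cst n_gt0 m_gt0 (inr i) _); congr (_ * _).
  by apply: eq_bigr => v _; exact: IH1.
Qed.

(** Parity: simultaneous walkers in opposite parts change sides together. *)
Lemma meet_prob_cross k i j :
  meet_prob k (inl i) (inr j) = 0 /\ meet_prob k (inr j) (inl i) = 0.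
Proof.
elim: k i j => [|k IH] i j; first by rewrite !meet_prob0.
rewrite !meet_probS //; split; rewrite /= (eq_bigr (fun=> 0)) ?big1 ?mulr0 // => l _.
  by rewrite big1 ?mulr0 // => l' _; exact: (IH l' l).2.
by rewrite big1 ?mulr0 // => l' _; exact: (IH l l').1.
Qed.

Definition in_left (v : V) : bool := if v is inl _ then true else false.

(** After its [d] solitary steps the walker from [v] is in the part opposite to [u], where
    [meet_prob_cross] applies. *)
Lemma lag_meet_prob_odd d k u v : odd d = in_left v -> lag_meet_prob d k (inl u) v = 0.
Proof.
elim: d v => [|d IH] v.
  by case: v => // j _; rewrite /lag_meet_prob addn0; exact: (meet_prob_cross k u j).1.
rewrite lag_meet_probS; case: v => i /= h.
  by rewrite big1 ?mulr0 // => j _; apply: IH; move: h; case: (odd d).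
by rewrite big1 ?mulr0 // => j _; apply: IH; move: h; case: (odd d).
Qed.

(** Averaging over the start of the later walker makes the induction work: at [e = 0] the individual
    probabilities depend on whether the start is [u]. *)
Lemma lag_meet_prob_even e k u :
  al * \sum_i lag_meet_prob e.*2 k (inl u) (inl i) = x ^+ e * (mean_meet k).1.
Proof.
elim: e => [|e IH].
  rewrite mul1r -((mean_meetE k).1 u) /=; congr (_ * _); apply: eq_bigr => i _.
  by rewrite /lag_meet_prob addn0.
have h i : lag_meet_prob e.+1.*2 k (inl u) (inl i) = x ^+ e.+1 * (mean_meet k).1.
  rewrite doubleS lag_meet_probS /=.
  rewrite (eq_bigr (fun=> q * (x ^+ e * (mean_meet k).1))); last first.
    by move=> j _; rewrite lag_meet_probS /= IH.
  have := nbr_mean_cst n_gt0 m_gt0 (inl i) (q * (x ^+ e * (mean_meet k).1)).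
  by rewrite /nbr_mean => ->; rewrite (exprS x e); ring.
rewrite (eq_bigr _ (fun i _ => h i)).
exact: (nbr_mean_cst n_gt0 m_gt0 (inr (Ordinal m_gt0))).
Qed.

Definition lag_meet_value (d : nat) (a : R) : R :=
  if d is 0 then 1 else if odd d then 0 else x ^+ d./2 * a.

Lemma lag_meet_probE d k u :
  lag_meet_prob d k (inl u) (inl u) = lag_meet_value d (mean_meet k).1.
Proof.
case: d => [|[|d]]; rewrite /lag_meet_value.
- by rewrite /lag_meet_prob addn0; exact: meet_prob_refl.
- exact: lag_meet_prob_odd.
case: ifP => od; first exact: lag_meet_prob_odd.
have -> : d.+2 = (d./2).+1.*2.
  by rewrite doubleS -[in LHS](odd_double_half d); move: od; rewrite /= negbK => ->.
rewrite doubleK doubleS lag_meet_probS /=.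
rewrite (eq_bigr (fun=> q * (x ^+ d./2 * (mean_meet k).1))); last first.
  by move=> j _; rewrite lag_meet_probS /= lag_meet_prob_even.
have := nbr_mean_cst n_gt0 m_gt0 (inl u) (q * (x ^+ d./2 * (mean_meet k).1)).
by rewrite /nbr_mean => ->; rewrite (exprS x d./2); ring.
Qed.

(** The pair [(p, pB)] is the fixed point of the affine recursion of [mean_meet]; errors are at most
    1 initially and shrink by a factor [x] or better at each step. *)
Lemma mean_meet_cvg :
  (mean_meet k).1 @[k --> \oo] --> second_moment n m eps.
Proof.
set p := second_moment n m eps; pose pB := be + (1 - be) * x * p.
have [/andP[x0 x1] /andP[a0 a1] /andP[b0 b1]] := 
  And3 (retention_bounds eps01) (inv_nat_bounds R n_gt0) (inv_nat_bounds R m_gt0).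
have p0 : 0 < p := second_moment_gt0 n_gt0 m_gt0 eps01.
have p1 : p <= 1 := second_moment_le1 n_gt0 m_gt0 eps01.
have pE : p = al + (1 - al) * x * pB.
  by rewrite {1}/p (second_momentE n_gt0 m_gt0 eps01) /pair_decay /pB -/p; ring.
have pB0 : 0 <= pB by rewrite /pB; nonneg.
have pB1 : pB <= 1.
  rewrite -subr_ge0; have -> : 1 - pB = (1 - be) * ((1 - x) + x * (1 - p)) by rewrite /pB; ring.
  by nonneg.
have bound k : `|(mean_meet k).1 - p| <= x ^+ k /\ `|(mean_meet k).2 - pB| <= x ^+ k.
  elim: k => [|k [IH1 IH2]] /=.
    by rewrite expr0; split; rewrite ler_norml; lra.
  split.
    rewrite [X in _ - X]pE opprD addrACA subrr add0r -mulrBr normrM (exprS x k).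
    apply: ler_pM => //; rewrite normrM (gtr0_norm x0) ger0_norm ?subr_ge0 //.
    by apply: ler_piMl; [exact: ltW | rewrite gerBl ltW].
  rewrite opprD addrACA subrr add0r -mulrBr normrM (exprS x k).
  apply: ler_pM => //; rewrite normrM (gtr0_norm x0) ger0_norm ?subr_ge0 //.
  by apply: ler_piMl; [exact: ltW | rewrite gerBl ltW].
have g0 : x ^+ k @[k --> \oo] --> (0 : R).
  by apply: cvg_expr; rewrite gtr0_norm.
apply/cvgrPdist_le => e e0; move/cvgrPdist_le : g0 => /(_ _ e0).
apply: filterS => k; rewrite sub0r normrN ger0_norm; last by apply: exprn_ge0; exact: ltW.
by move=> h; apply: le_trans h; rewrite distrC; exact: (bound k).1.
Qed.

Lemma p_E (dsp : measure_display) (Omega : measurableType dsp)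
    (P : probability Omega R) (N : nvm P (complete_bipartite n m) eps) (u : 'I_n) d :
  p_ N (inl u) d = (lag_meet_value d (second_moment n m eps))%:E.
Proof.
have hP t : P (paths_meet N (inl u) d t) = (lag_meet_value d (mean_meet t).1)%:E.
  rewrite -(lag_meet_probE d t u).
  (* [lag_meet] expects the latest noise first, whereas [history] ends with it. *)
  pose Q (_ : config n m) l := lag_meet d (rev l) (inl u) (inl u).
  have -> : paths_meet N (inl u) d t =
    [set w | Q (init_at N w) (history N (t + d) w)].
    by apply/seteqP; split=> w /paths_meetE.
  rewrite (prob_history N eps01 Q (t + d)).2 /Q -mulr_suml init_pmf_sum1 mul1r.
  congr (_%:E).
  exact: (expect_seq_rev nu_sum1 (t + d) (fun l => (lag_meet d l (inl u) (inl u))%:R)).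
rewrite /p_; apply: cvg_lim => //.
rewrite (_ : (fun t => _) = (fun t => (lag_meet_value d (mean_meet t).1)%:E)); last first.
  by apply/funext => t; exact: hP.
apply: cvg_EFin; first by near=> t.
have -> : fine \o (fun t => (lag_meet_value d (mean_meet t).1)%:E) =
  (fun t => lag_meet_value d (mean_meet t).1) by [].
rewrite /lag_meet_value; case: d {hP} => [|d]; first exact: cvg_cst.
case: ifP => _; first exact: cvg_cst.
by apply: cvgM; [exact: cvg_cst | exact: mean_meet_cvg].
Unshelve. all: end_near. Qed.

End MeetingProbability.
End Walks.

(** * Stars *)

Section Star.
Variables (R : realType) (m : nat) (eps : R).
Hypotheses (m_gt0 : (0 < m)%N) (eps01 : 0 < eps < 1).
Variable u : 'I_1.

Local Notation V := ('I_1 + 'I_m)%type.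
Local Notation noise := (noise 1 m).
Local Notation config := (config 1 m).
Local Notation nu := (@noise_pmf R 1 m eps).
Local Notation step := (@nvm_step 1 m).
Local Notation K := (trans nu step).
Local Notation spin := (@spin R 1 m).
Local Notation inM := (@inr 'I_1 'I_m).
Local Notation B := (part_mean R inM).
Local Notation EN := (expect_seq nu).

Lemma init_prod (h : V -> bool -> R) :
  \sum_(z : config) init_pmf R z * \prod_v h v (z v) = \prod_v (2^-1 * (h v true + h v false)).
Proof.
under [RHS]eq_bigr do rewrite mulrDr -(big_bool _ (fun b => 2^-1 * h _ b)).
by rewrite bigA_distr_bigA /=; apply: eq_bigr => z _; rewrite /init_pmf -big_split.
Qed.

Lemma init_center (g : bool -> R) :
  \sum_(z : config) init_pmf R z * g (z (inl u)) = 2^-1 * (g true + g false).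
Proof.
have := init_prod (fun v b => if v == inl u then g b else 1).
rewrite [in RHS](bigD1 (inl u)) //= eqxx [X in _ = _ * X]big1 => [|v /negbTE ->]; last by field.
rewrite mulr1 => <-; apply: eq_bigr => z _; congr (_ * _).
by rewrite (bigD1 (inl u)) //= eqxx big1 ?mulr1 // => v /negbTE ->.
Qed.

(** Initially the leaves are independent of the centre and their spins have mean 0. *)
Lemma init_center_leaves (g : bool -> R) :
  \sum_(z : config) init_pmf R z * (g (z (inl u)) * B z) = 0.
Proof.
have h j : \sum_(z : config) init_pmf R z * (g (z (inl u)) * spin z (inr j)) = 0.
  have := init_prod (fun v b => if v == inl u then g b
     else if v == inr j then (if b then 1 else -1) else 1).
  rewrite [in RHS](bigD1 (inr j)) //= eqxx subrr mulr0 mul0r => e; rewrite -[RHS]e.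
  apply: eq_bigr => z _; congr (_ * _).
  rewrite (bigD1 (inl u)) //= (bigD1 (inr j)) //= !eqxx big1 ?mulr1 //.
  by move=> v /andP[/negbTE -> /negbTE ->].
transitivity (m%:R^-1 * \sum_j \sum_(z : config) init_pmf R z * (g (z (inl u)) * spin z (inr j))).
  rewrite [X in _ = _ * X]exchange_big mulr_sumr /=. apply: eq_bigr => z _.
  rewrite /part_mean; under [in RHS]eq_bigr do rewrite mulrA.
  by rewrite -mulr_sumr; ring.
by rewrite big1 ?mulr0.
Qed.

(** On a two-point set every function is affine in the spin, so kernel computations reduce to
    spins. *)
Lemma bool_fun_spin (g : bool -> R) (z : config) v :
  g (z v) = 2^-1 * (g true + g false) + 2^-1 * (g true - g false) * spin z v.
Proof. by rewrite /spin; case: (z v); field. Qed.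

(* The centre and the leaves are conditionally independent given the past, and
   each leaf was copied from the centre. *)
Lemma trans_center_leaves (g : bool -> R) z :
  K (fun z' => g (z' (inl u)) * B z') z =
  (1 - eps) * spin z (inl u) * K (fun z' => g (z' (inl u))) z.
Proof.
have leaf j : drift eps z (inr j) = (1 - eps) * spin z (inl u).
  by rewrite /drift /= big_ord1 invr1 mul1r (ord1 u).
have KB : K B z = (1 - eps) * spin z (inl u).
  by apply: (@trans_part_mean R 1 m eps).
have Ksp j : K (fun z' => spin z' (inl u) * spin z' (inr j)) z =
   drift eps z (inl u) * ((1 - eps) * spin z (inl u)).
  have := @trans_spin_prod R 1 m eps isT m_gt0 (inl u |: [set inr j])%SET z.
  rewrite big_setU1 ?inE //= big_set1 leaf => <-.
  by apply: trans_ext => z'; rewrite big_setU1 ?inE //= big_set1.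
have KsB : K (fun z' => spin z' (inl u) * B z') z =
   drift eps z (inl u) * ((1 - eps) * spin z (inl u)).
  rewrite (@trans_ext _ _ _ _ _ _ (fun z' => m%:R^-1 * \sum_j spin z' (inl u) * spin z' (inr j))); last first.
    by move=> z'; rewrite /part_mean mulrCA mulr_sumr.
  rewrite transZ trans_sum; under eq_bigr do rewrite Ksp.
  exact: (@nbr_mean_cst R 1 m isT m_gt0 (inl u)).
have Ks : K (fun z' => spin z' (inl u)) z = drift eps z (inl u).
  have := @trans_spin_prod R 1 m eps isT m_gt0 [set inl u]%SET z.
  by rewrite big_set1 => <-; apply: trans_ext => z'; rewrite big_set1.
rewrite (trans_ext _ _ (fun z' => bool_fun_spin g z' (inl u))).
set g0 := _ * (_ + _); set g1 := _ * (_ - _).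
rewrite (transD _ _ (fun=> g0) (fun z => g1 * spin z (inl u))) /=.
rewrite (transZ _ _ g1 (fun z => spin z (inl u))) trans_cst ?noise_pmf_sum1 // Ks.
rewrite (@trans_ext _ _ _ _ _ _ ((fun z' => g0 * B z') \+ (fun z' => g1 * (spin z' (inl u) * B z')))).
  rewrite transD /= (transZ _ _ g0 B) KB.
  by rewrite (transZ _ _ g1 (fun z' => spin z' (inl u) * B z')) KsB; ring.
by move=> z'; rewrite bool_fun_spin -/g0 -/g1 /=; ring.
Qed.

Definition center_path (z : config) (l : seq noise) : seq bool :=
  [seq run step z (take i l) (inl u) | i <- iota 0 (size l).+1].

Lemma center_rcons z l s :
  center_path z (rcons l s) = rcons (center_path z l) (run step z (rcons l s) (inl u)).
Proof.
rewrite /center_path size_rcons -[(size l).+2]addn1 iotaD map_cat [map _ (iota (0 + _) _)]/= cats1 add0n.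
rewrite [take (size l).+1 _]take_oversize ?size_rcons //; congr (rcons _ _).
apply/eq_in_map => i; rewrite mem_iota add0n ltnS => /= il.
by rewrite -cats1 takel_cat.
Qed.

Definition center_law (T : nat) (F : seq bool -> R) : R :=
  \sum_(z : config) init_pmf R z * EN T (fun l => F (center_path z l)).

Lemma center_law0 F : center_law 0 F = 2^-1 * (F [:: true] + F [:: false]).
Proof. exact: (init_center (fun b => F [:: b])). Qed.

(** The mean of [F] after one more bit whose spin has conditional mean [q], that is, a bit that is
    true with probability (1 + q) / 2. *)
Definition fold_last (q : R) (F : seq bool -> R) (y : seq bool) : R :=
  2^-1 * (F (rcons y true) + F (rcons y false)) +
  2^-1 * (F (rcons y true) - F (rcons y false)) * q.

Lemma expect_last T z F : EN T.+1 (fun l => F (center_path z l)) =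
  EN T (fun l => fold_last ((1 - eps) * B (run step z l)) F (center_path z l)).
Proof.
rewrite -[T.+1]addn1 expect_seq_cat; apply: expect_seq_ext => l _ /=.
set z' := run step z l; transitivity (K (fun y => F (rcons (center_path z l) (y (inl u)))) z').
  by apply: eq_bigr => s _; rewrite cats1 center_rcons run_rcons.
rewrite (trans_ext _ _ (fun y => bool_fun_spin (fun b => F (rcons (center_path z l) b)) y (inl u))).
rewrite (transD _ _ (fun=> _) (fun z => _ * spin z (inl u))) /=.
by rewrite (transZ _ _ _ (fun z => spin z (inl u))) trans_cst ?noise_pmf_sum1 // trans_spinN.
Qed.

(** At time 1 the centre consults the initial leaves, whose mean spin is uncorrelated with any
    function of the initial centre, so the new bit is a fair coin. *)
Lemma center_law1 F : center_law 1 F =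
  center_law 0 (fun y => 2^-1 * (F (rcons y true) + F (rcons y false))).
Proof.
rewrite /center_law; under eq_bigr do rewrite expect_last.
pose g b := 2^-1 * (F [:: b; true] - F [:: b; false]).
have := init_center_leaves (fun b => (1 - eps) * g b).
under [X in X = _ -> _]eq_bigr do rewrite -mulrA.
move=> e; rewrite -[RHS]addr0 -[X in _ = _ + X]e -big_split /=; apply: eq_bigr => z _.
by rewrite -mulrDr /fold_last /g; congr (_ * _); rewrite /=; ring.
Qed.

(** The leaves consulted at time [T.+2] were themselves updated from the centre of time [T]. So the
    last spin has conditional mean [(1 - eps) ^+ 2] times a spin that the observed path already
    contains, and the recursion involves [eps] alone. *)
Lemma center_lawSS T F : center_law T.+2 F =
  center_law T.+1 (fun y => fold_last ((1 - eps) ^+ 2 * (if nth true y T then 1 else -1)) F y).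
Proof.
rewrite /center_law; apply: eq_bigr => z _; congr (_ * _).
rewrite expect_last -[T.+1]addn1 !expect_seq_cat; apply: expect_seq_ext => l sl /=.
set z1 := run step z l; set y := center_path z l.
pose g0 b := 2^-1 * (F (rcons (rcons y b) true) + F (rcons (rcons y b) false)).
pose g1 b := 2^-1 * (F (rcons (rcons y b) true) - F (rcons (rcons y b) false)).
have ny b : (if nth true (rcons y b) T then 1 else -1) = spin z1 (inl u).
  have sy : size y = T.+1 by rewrite /y /center_path size_map size_iota sl.
  rewrite nth_rcons sy ltnS leqnn /y /center_path (nth_map 0%N) ?size_iota ?sl //.
  by rewrite nth_iota // add0n -sl take_size.
transitivity (K (fun z2 : config => g0 (z2 (inl u)) + (1 - eps) * (g1 (z2 (inl u)) * B z2)) z1).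
  apply: eq_bigr => s _; congr (_ * _).
  by rewrite cats1 center_rcons run_rcons /fold_last /g0 /g1 /=; ring.
transitivity (K (fun z2 : config => g0 (z2 (inl u)) + (1 - eps) ^+ 2 * spin z1 (inl u) * g1 (z2 (inl u))) z1).
  rewrite (transD _ _ (fun z2 : config => g0 (z2 (inl u))) (fun z2 : config => (1 - eps) * (g1 (z2 (inl u)) * B z2))) /=.
  rewrite (transZ _ _ _ (fun z2 : config => g1 (z2 (inl u)) * B z2)) (trans_center_leaves g1).
  rewrite (transD _ _ (fun z2 : config => g0 (z2 (inl u))) (fun z2 : config => _ * g1 (z2 (inl u)))) /=.
  rewrite (transZ _ _ _ (fun z2 : config => g1 (z2 (inl u)))).
  by ring.
apply: eq_bigr => s _; congr (_ * _).
by rewrite cats1 center_rcons run_rcons /fold_last ny /g0 /g1 /=; ring.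
Qed.

End Star.

(** * Comparison of two graphs *)

(** Both laws satisfy [center_law0], [center_law1] and [center_lawSS], where the number of leaves
    does not enter. *)
Lemma center_law_indep (R : realType) (m1 m2 : nat) (eps : R) (u1 u2 : 'I_1) T F :
  (0 < m1)%N -> (0 < m2)%N -> 0 < eps < 1 ->
  center_law m1 eps u1 T F = center_law m2 eps u2 T F.
Proof.
move=> m1_gt0 m2_gt0 eps01.
have base F' : center_law m1 eps u1 0 F' = center_law m2 eps u2 0 F'.
  by rewrite !center_law0.
have step T' F' : center_law m1 eps u1 T'.+1 F' = center_law m2 eps u2 T'.+1 F'.
  elim: T' F' => [|T' IH] F'; first by rewrite !center_law1.
  by rewrite !center_lawSS.
by case: T.
Qed.

Section StarObservations.
Variables (R : realType) (m : nat) (eps : R).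
Hypotheses (m_gt0 : (0 < m)%N) (eps01 : 0 < eps < 1).
Variables (dsp : measure_display) (Omega : measurableType dsp).
Variables (P : probability Omega R) (N : nvm P (complete_bipartite 1 m) eps).
Variable u : 'I_1.

Lemma observationsE t w :
  observations N (inl u) t w =
  [seq nat_of_bool b | b <- center_path u (init_at N w) (history N t w)] :> seq nat.
Proof.
apply: (@eq_from_nth _ 0%N) => [|i]; rewrite size_tuple.
  by rewrite size_map size_map size_iota size_tuple.
move=> it; have -> : i = Ordinal it by [].
rewrite -tnth_nth tnth_mktuple nvm_stateE /center_path size_tuple.
rewrite (nth_map false) ?size_map ?size_iota // (nth_map 0%N) ?size_iota //.
by rewrite nth_iota // add0n take_history.
Qed.

(** A Boolean test on paths of the centre is the form in which [prob_history] accepts a set of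
    observations. *)
Definition center_pred (t : nat) (A : set (t.+1.-tuple nat)) (y : seq bool) : bool :=
  `[< exists2 o : t.+1.-tuple nat, o = [seq nat_of_bool b | b <- y] :> seq nat & A o >].

Lemma prob_observations t (A : set (t.+1.-tuple nat)) :
  measurable [set w | A (observations N (inl u) t w)] /\
  P [set w | A (observations N (inl u) t w)] =
    (center_law m eps u t (fun y => (center_pred A y)%:R))%:E.
Proof.
pose Q (z : config 1 m) l := center_pred A (center_path u z l).
have -> : [set w | A (observations N (inl u) t w)] =
    [set w | Q (init_at N w) (history N t w)].
  apply/seteqP; split=> w /=.
    by move=> Aw; apply/asboolP; exists (observations N (inl u) t w) => //; exact: observationsE.
  move=> /asboolP[y yE Ay]; suff -> : observations N (inl u) t w = y by [].
  by apply: val_inj; rewrite /= yE -observationsE.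
exact: (prob_history N eps01 Q t).
Qed.

End StarObservations.

(** [A1] and [B1] have equal probability, and [B1] and [B2] are disjoint. The joint event lies in
    both [A1] and [B2], so its probability is at most 1/2 at every time. *)
Lemma star_not_distinguishable (R : realType) (m1 m2 : nat) (eps : R)
    (dsp : measure_display) (Omega : measurableType dsp)
    (P : probability Omega R)
    (N1 : nvm P (complete_bipartite 1 m1) eps)
    (N2 : nvm P (complete_bipartite 1 m2) eps) (u1 u2 : 'I_1) :
  (0 < m1)%N -> (0 < m2)%N -> 0 < eps < 1 ->
  ~ nvm_distinguishable N1 (inl u1) N2 (inl u2).
Proof.
move=> m1_gt0 m2_gt0 eps01 [S [S1 [S2 [dis]]]]; set J := fun t : nat => P _.
move=> Jcvg; suff half t : (J t <= (2^-1)%:E)%E.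
  have : ((1 : \bar R) <= (2^-1)%:E)%E.
    by rewrite -(cvg_lim _ Jcvg) //; apply: lime_le; [exact: cvgP Jcvg | exact: nearW].
  by rewrite lee_fin; lra.
pose A1 := [set w | S1 t (S t (observations N1 (inl u1) t w))].
pose B1 := [set w | S1 t (S t (observations N2 (inl u2) t w))].
pose B2 := [set w | S2 t (S t (observations N2 (inl u2) t w))].
have [mA1 pA1] := prob_observations eps01 N1 u1 (fun o => S1 t (S t o)).
have [mB1 pB1] := prob_observations eps01 N2 u2 (fun o => S1 t (S t o)).
have [mB2 pB2] := prob_observations eps01 N2 u2 (fun o => S2 t (S t o)).
rewrite -/A1 in mA1 pA1; rewrite -/B1 in mB1 pB1; rewrite -/B2 in mB2 pB2.
have JE : J t = P (A1 `&` B2) by [].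
have mJ : measurable (A1 `&` B2) by exact: measurableI.
have J1 : (J t <= P A1)%E by rewrite JE le_measure ?inE //; exact: subIsetl.
have J2 : (J t <= P B2)%E by rewrite JE le_measure ?inE //; exact: subIsetr.
have B12 : (P B1 + P B2 <= 1)%E.
  rewrite -measureU //; first by apply: probability_le1; exact: measurableU.
  rewrite -subset0 => w [/= b1 b2].
  by have := dis t; rewrite -subset0; apply; split; [exact: b1 | exact: b2].
have AB : P A1 = P B1 by rewrite pA1 pB1 (center_law_indep u1 u2 _ _ m1_gt0 m2_gt0).
have Jfin : J t \is a fin_num by rewrite JE fin_num_measure.
move: J1 J2 B12; rewrite AB pB1 pB2 -(fineK Jfin) !lee_fin => J1 J2 B12.
lra.
Qed.

(** * Equality of second moments as a cubic equation, and the separating statistics *)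

Section MomentComparison.
Variables (R : realType) (eps : R).
Hypothesis eps01 : 0 < eps < 1.
Local Notation x := ((1 - eps) ^+ 2).

(** The numerator of the difference of the two second moments, each written over the denominator n m
    (1 - l). *)
Definition moment_cubic (n1 m1 n2 m2 : R) (y : R) : R :=
  (m1 + (n1 - 1) * y) * (n2 * m2 - y ^+ 2 * (n2 - 1) * (m2 - 1))
  - (m2 + (n2 - 1) * y) * (n1 * m1 - y ^+ 2 * (n1 - 1) * (m1 - 1)).

Lemma second_moment_eq n1 m1 n2 m2 :
  (0 < n1)%N -> (0 < m1)%N -> (0 < n2)%N -> (0 < m2)%N ->
  second_moment n1 m1 eps = second_moment n2 m2 eps <->
  moment_cubic n1%:R m1%:R n2%:R m2%:R x = 0.
Proof.
move=> n1_gt0 m1_gt0 n2_gt0 m2_gt0; have /andP[x0 x1] := retention_bounds eps01.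
have D n m : (0 < n)%N -> (0 < m)%N ->
    0 < n%:R * m%:R - x ^+ 2 * (n%:R - 1) * (m%:R - 1) :> R /\
    second_moment n m eps =
     (m%:R + (n%:R - 1) * x) / (n%:R * m%:R - x ^+ 2 * (n%:R - 1) * (m%:R - 1)).
  move=> n0 m0; have l1 := pair_decay_lt1 n0 m0 eps01.
  have nR : 0 < n%:R :> R by rewrite ltr0n.
  have mR : 0 < m%:R :> R by rewrite ltr0n.
  have nz : n%:R != 0 :> R by rewrite gt_eqF.
  have mz : m%:R != 0 :> R by rewrite gt_eqF.
  have e : n%:R * m%:R - x ^+ 2 * (n%:R - 1) * (m%:R - 1) = n%:R * m%:R * (1 - pair_decay n m eps).
    by rewrite /pair_decay; field; rewrite nz mz.
  have pos : 0 < n%:R * m%:R * (1 - pair_decay n m eps) by rewrite !mulr_gt0 ?subr_gt0.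
  split; first by rewrite e.
  rewrite (second_moment_closed n0 m0 eps01) e.
  have lz : 1 - pair_decay n m eps != 0 by rewrite gt_eqF // subr_gt0.
  by field; rewrite nz mz lz.
have [d1 ->] := D _ _ n1_gt0 m1_gt0; have [d2 ->] := D _ _ n2_gt0 m2_gt0.
rewrite /moment_cubic; split=> [/eqP|/eqP].
  by rewrite eqr_div ?lt0r_neq0 // => /eqP ->; rewrite subrr.
by rewrite subr_eq0 => h; apply/eqP; rewrite eqr_div ?lt0r_neq0.
Qed.

Lemma limit_mean_lag n m (u : 'I_n) gs : (0 < n)%N -> (0 < m)%N ->
  limit_mean m eps u (sumn gs) (lag_product R gs) =
  stat (@noise_pmf R n m eps) (@nvm_step n m) [ffun=> false] (@lag_mean R n m eps u gs).
Proof.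
by move=> n0 m0; apply: stat_ext => z; exact: lag_window_mean.
Qed.

Definition repeat_obs (h : nat -> nat) : R := (h 0%N == h 2%N)%:R.

Lemma repetitionE : repetition R 2 = window_stat 2 repeat_obs.
Proof.
apply: functional_extensionality_dep => t; apply/funext => o; rewrite /repetition /window_stat /repeat_obs.
by under [in RHS]eq_bigr do rewrite addn0.
Qed.

(** The indicator that two bits agree is (1 + s_0 s_2) / 2, and [stat_lag2] gives the correlation at
    lag 2. *)
Lemma limit_mean_repeat n m (u : 'I_n) : (0 < n)%N -> (0 < m)%N ->
  limit_mean m eps u 2 repeat_obs = 2^-1 * (1 + x * second_moment n m eps).
Proof.
move=> n0 m0.
have nu0 := @noise_pmf_ge0 R n m eps eps01.
have nu1 := @noise_pmf_sum1 R n m eps n0 m0.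
have rs := @refresh_step n m.
have rp := @refresh_pos R n m eps n0 m0 eps01.
rewrite -(stat_lag2 n0 m0 eps01 u) /limit_mean.
rewrite -[X in _ * (X + _)](stat_cst nu1 (@nvm_step n m) [ffun=> false]).
rewrite -(statD nu0 nu1 rs rp) -(statZ nu0 nu1 rs rp); apply: stat_ext => z.
transitivity (2^-1 * (1 + lag_mean eps u [:: 2%N] z)); last by [].
rewrite -lag_window_mean /window_mean -[X in X + _](expect_seq_cst nu1 2).
rewrite -expect_seqD -expect_seqZ; apply: expect_seq_ext => l _.
rewrite /obs_window /repeat_obs /lag_product /sign_of_nat addn0 take0 mulr1.
set a := fun_of_fin (run _ _ [::]) _; set b := fun_of_fin (run _ _ _) _.
by case: a; case: b; rewrite /=; field.
Qed.

Lemma repetition_distinguishes n1 m1 n2 m2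
    (dsp : measure_display) (Omega : measurableType dsp) (P : probability Omega R)
    (N1 : nvm P (complete_bipartite n1 m1) eps)
    (N2 : nvm P (complete_bipartite n2 m2) eps) (u1 : 'I_n1) (u2 : 'I_n2) :
  (0 < n1)%N -> (0 < m1)%N -> (0 < n2)%N -> (0 < m2)%N ->
  moment_cubic n1%:R m1%:R n2%:R m2%:R x != 0 ->
  distinguishable_by N1 (inl u1) N2 (inl u2) (@repetition R 2).
Proof.
move=> n1_gt0 m1_gt0 n2_gt0 m2_gt0 cub; rewrite repetitionE.
apply: distinguishable_window => // [h h' hh'|h _|].
- by rewrite /repeat_obs !hh'.
- by rewrite /repeat_obs; case: (_ == _); rewrite ?normr1 ?normr0.
rewrite !limit_mean_repeat //; apply: contra_neq cub => e.
apply/(second_moment_eq n1_gt0 m1_gt0 n2_gt0 m2_gt0).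
have /andP[x0 _] := retention_bounds eps01.
have /mulfI inj2 : 2^-1 != 0 :> R by rewrite invr_neq0.
have /mulfI injx : x != 0 by rewrite gt_eqF.
by apply: injx; apply: (@addrI _ 1); exact: inj2.
Qed.

Lemma lag_product_local gs h h' :
  (forall b, (b <= sumn gs)%N -> h b = h' b) -> lag_product R gs h = lag_product R gs h'.
Proof.
elim: gs h h' => [|g gs IH] h h' hh' /=; first by rewrite hh'.
by rewrite hh' //; congr (_ * _); apply: IH => b bs; apply: hh'; rewrite /= leq_add2l.
Qed.

Lemma lag_product_bound gs h : (forall b, (h b <= 1)%N) -> `|lag_product R gs h| <= 1.
Proof.
have s k : (k <= 1)%N -> `|sign_of_nat R k| <= 1.
  by case: k => [|[]] // _; rewrite /sign_of_nat ler_norml; lra.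
elim: gs h => [|g gs IH] h h1 /=; first by rewrite mulr1 s.
by rewrite normrM mulr_ile1 ?s ?IH.
Qed.

(** If the gaps 2, 2, 2 give equal limits, the gaps 2, 4, 2 cannot, so one of the two statistics
    separates the graphs. *)
Lemma lags_distinguish n1 m1 n2 m2
    (dsp : measure_display) (Omega : measurableType dsp) (P : probability Omega R)
    (N1 : nvm P (complete_bipartite n1 m1) eps)
    (N2 : nvm P (complete_bipartite n2 m2) eps) (u1 : 'I_n1) (u2 : 'I_n2) :
  (1 < n1)%N -> (1 < m1)%N -> (1 < n2)%N -> (1 < m2)%N -> n1 <> n2 ->
  second_moment n1 m1 eps = second_moment n2 m2 eps ->
  nvm_distinguishable N1 (inl u1) N2 (inl u2).
Proof.
move=> n1_gt1 m1_gt1 n2_gt1 m2_gt1 n12 pE.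
have [n1_gt0 m1_gt0 n2_gt0 m2_gt0] : [/\ (0 < n1)%N, (0 < m1)%N, (0 < n2)%N & (0 < m2)%N].
  by split; exact: ltnW.
have /andP[x0 x1] := retention_bounds eps01; have xz : x != 0 by rewrite gt_eqF.
have [e6|ne6] := eqVneq (limit_mean m1 eps u1 6 (lag_product R [:: 2; 2; 2]%N))
                   (limit_mean m2 eps u2 6 (lag_product R [:: 2; 2; 2]%N)); last first.
  exists (window_stat 6 (lag_product R [:: 2; 2; 2]%N)); apply: distinguishable_window => //.
    exact: (@lag_product_local [:: 2; 2; 2]%N).
  exact: (@lag_product_bound [:: 2; 2; 2]%N).
exists (window_stat 8 (lag_product R [:: 2; 4; 2]%N)); apply: distinguishable_window => //.
- exact: (@lag_product_local [:: 2; 4; 2]%N).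
- exact: (@lag_product_bound [:: 2; 4; 2]%N).
apply/eqP; move: e6.
rewrite (limit_mean_lag u1 [:: 2; 2; 2]%N) // (limit_mean_lag u2 [:: 2; 2; 2]%N) //.
rewrite (limit_mean_lag u1 [:: 2; 4; 2]%N) // (limit_mean_lag u2 [:: 2; 4; 2]%N) //.
rewrite !stat_lag222 // !stat_lag242 // pE => /(mulfI xz) /addrI lV /(mulfI xz) /addrI lV2.
have V1 := fourth_cov_gt0 n1_gt0 m1_gt0 eps01 u1 n1_gt1 m1_gt1.
have inv k : (1 < k)%N -> 0 < (k%:R^-1 : R) < 1.
  move=> k1; have k0 : (0 < k)%N by exact: ltnW.
  by rewrite invr_gt0 ltr0n k0 /= invf_lt1 ?ltr0n // ltr1n.
have pair_decay_gt0 n m : (1 < n)%N -> (1 < m)%N -> 0 < pair_decay n m eps.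
  move=> n1' m1'; have /andP[a0 a1] := inv _ n1'; have /andP[b0 b1] := inv _ m1'.
  rewrite /pair_decay; apply: mulr_gt0; last by rewrite subr_gt0.
  by apply: mulr_gt0; [exact: exprn_gt0 | rewrite subr_gt0].
(* The values of l V and of l^2 V agree for the two graphs; dividing by l V > 0 gives equal l. *)
have pair_decayE : pair_decay n1 m1 eps = pair_decay n2 m2 eps.
  have lVz : pair_decay n1 m1 eps * fourth_cov m1 eps u1 != 0.
    by rewrite gt_eqF // mulr_gt0 // pair_decay_gt0.
  apply: (mulIf lVz); rewrite [in RHS]lV mulrA -expr2 lV2; ring.
have l1 : 1 - pair_decay n2 m2 eps != 0 by rewrite gt_eqF // subr_gt0 pair_decay_lt1.
move: pE; rewrite (second_moment_closed n1_gt0 m1_gt0 eps01) (second_moment_closed n2_gt0 m2_gt0 eps01) pair_decayE.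
move=> /(mulIf (invr_neq0 l1)) cE.
have lE : (1 - n1%:R^-1) * (1 - m1%:R^-1) = (1 - n2%:R^-1) * (1 - m2%:R^-1) :> R.
  have x2z : x ^+ 2 != 0 by rewrite expf_neq0.
  by apply: (mulfI x2z); rewrite !mulrA; exact: pair_decayE.
(* With a = 1/n and b = 1/m, the sum a + (1 - a) x b - x + x (1 - a) (1 - b) collapses to (1 - x) a,
   and [cE] and [lE] say that it is the same for both graphs. *)
have aE : (1 - x) * n1%:R^-1 = (1 - x) * n2%:R^-1 :> R.
  transitivity (n1%:R^-1 + (1 - n1%:R^-1) * x * m1%:R^-1 - x + x * ((1 - n1%:R^-1) * (1 - m1%:R^-1))); first by ring.
  by rewrite cE lE; ring.
apply: n12; apply/eqP; rewrite -(eqr_nat R); apply/eqP/invr_inj.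
by apply: (mulfI _ aE); rewrite subr_eq0 gt_eqF.
Qed.

End MomentComparison.

(** Multiplying by a power of X raises the degree to exactly 3 and keeps the root. *)
Lemma int_cubic_root (R : realType) (c : 'I_4 -> int) (y : R) :
  \sum_i (c i)%:~R * y ^+ i = 0 -> (exists i, c i != 0) ->
  exists p : {poly int}, size p = 4%N /\ root (map_poly intr p) y.
Proof.
move=> cy [i ci]; pose p := \poly_(j < 4) c (inord j).
have p_neq0 : p != 0.
  apply: contraNneq ci => p0; have := coef_poly 4 (fun j => c (inord j)) i.
  by rewrite -/p p0 coef0 ltn_ord inord_val => <-.
have p_size : (size p <= 4)%N by exact: size_poly.
exists (p * 'X^(4 - size p)); split.
  rewrite size_Mmonic ?monicXn // size_polyXn.
  have : (0 < size p)%N by rewrite size_poly_gt0.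
  by move: (size p) p_size => a; lia.
rewrite rmorphM /= rootM; apply/orP; left; apply/rootP.
rewrite (@horner_coef_wide _ 4); last by apply: leq_trans p_size; exact: size_poly.
rewrite -[RHS]cy; apply: eq_bigr => j _.
by rewrite coef_map /= coef_poly ltn_ord inord_val.
Qed.

Lemma moment_cubic_root (R : realType) (n1 m1 n2 m2 : nat) (y : R) :
  (0 < n1)%N -> (0 < m1)%N -> (0 < n2)%N -> (0 < m2)%N ->
  (n1, m1) <> (n2, m2) -> (1 < maxn n1 n2)%N ->
  moment_cubic n1%:R m1%:R n2%:R m2%:R y = 0 ->
  exists p : {poly int}, size p = 4%N /\ root (map_poly intr p) y.
Proof.
move=> n1_gt0 m1_gt0 n2_gt0 m2_gt0 nm n_gt1 cub.
pose c (i : 'I_4) : int := nth 0 [::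
  m1%:Z * m2%:Z * (n2%:Z - n1%:Z);
  (n1%:Z - 1) * n2%:Z * m2%:Z - (n2%:Z - 1) * n1%:Z * m1%:Z;
  m2%:Z * (n1%:Z - 1) * (m1%:Z - 1) - m1%:Z * (n2%:Z - 1) * (m2%:Z - 1);
  (n1%:Z - 1) * (n2%:Z - 1) * (m1%:Z - m2%:Z)] i.
apply: (@int_cubic_root R c).
  rewrite -[RHS]cub /moment_cubic !big_ord_recl big_ord0 /c /=.
  by rewrite !(rmorphM, rmorphB, rmorph1) /= -!pmulrn; ring.
(* If the constant coefficient vanishes, then n1 = n2 = n, and the linear one becomes n (n - 1) (m2
   - m1), which is nonzero because n > 1 and the pairs differ. *)
case: (eqVneq (c ord0) 0) => [c0|]; last by exists ord0.
exists (lift ord0 ord0); apply/eqP => c1; apply: nm.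
have nE : n1 = n2.
  move/eqP: c0; rewrite /c /= !mulf_eq0 => /orP[/orP[]|]; [lia | lia |].
  by rewrite subr_eq0 => /eqP[].
move: c1; rewrite /c /= nE -!mulrA -mulrBr => /eqP; rewrite mulf_eq0 => /orP[|]; first lia.
rewrite -mulrBr mulf_eq0 => /orP[|]; first lia.
by rewrite subr_eq0 => /eqP[->].
Qed.

(** In both cases the cubic factors, and its only factor that is not evidently nonzero is k - y -
    y^2 (k - 1) = (1 - y) + (k - 1) (1 - y^2) > 0. *)
Lemma moment_cubic_neq0 (R : realType) (n1 m1 n2 m2 : nat) (y : R) : 0 < y < 1 ->
  (0 < n1)%N -> (0 < m1)%N -> (n1, m1) <> (n2, m2) ->
  (n1 = n2 /\ (1 < n1)%N) \/ m1 = m2 ->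
  moment_cubic n1%:R m1%:R n2%:R m2%:R y != 0.
Proof.
case/andP=> y0 y1 n1_gt0 m1_gt0 nm.
have pos k : (0 < k)%N -> 0 < k%:R - y - y ^+ 2 * (k%:R - 1).
  move=> k0; have -> : k%:R - y - y ^+ 2 * (k%:R - 1) = (1 - y) + (k%:R - 1) * (1 - y ^+ 2) by ring.
  rewrite ltr_pwDl ?subr_gt0 // mulr_ge0 ?subr_ge0 ?ler1n //.
  by rewrite expr_le1 // ltW.
have nat_neq (a b : nat) : a <> b -> b%:R - a%:R != 0 :> R.
  by move=> ab; rewrite subr_eq0 eqr_nat; apply/eqP => ba; apply: ab.
case=> [[nE n_gt1]|mE].
  have mm : m1 <> m2 by move=> mE; apply: nm; rewrite nE mE.
  have -> : moment_cubic n1%:R m1%:R n2%:R m2%:R y =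
     y * (n1%:R - 1) * (m2%:R - m1%:R) * (n1%:R - y - y ^+ 2 * (n1%:R - 1)).
    by rewrite /moment_cubic -nE; ring.
  rewrite !mulf_neq0 ?nat_neq ?(gt_eqF y0) ?gt_eqF ?pos //.
  by rewrite subr_gt0 ltr1n.
have nn : n1 <> n2 by move=> nE; apply: nm; rewrite nE mE.
have -> : moment_cubic n1%:R m1%:R n2%:R m2%:R y =
   m1%:R * (n2%:R - n1%:R) * (m1%:R - y - y ^+ 2 * (m1%:R - 1)).
  by rewrite /moment_cubic -mE; ring.
by rewrite !mulf_neq0 ?nat_neq ?gt_eqF ?pos ?ltr0n.
Qed.

(* For [(n1, m1) = (s + 1, 2 s)] and [(n2, m2) = (2 s + 2, s)] the cubic is
   [s (1 - y)] times a quadratic whose root tends to 1 as [s] grows. *)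
Lemma moment_cubic_near1 (R : realType) (k : nat) (y0 : R) : 0 < y0 < 1 ->
  exists (s : nat) (y : R), [/\ (k.+1 < s)%N, y0 < y < 1 &
    moment_cubic s.+1%:R (s.*2)%:R (s.+1.*2)%:R s%:R y = 0].
Proof.
case/andP=> y00 y01.
have d0 : 0 < 1 - y0 ^+ 2 by rewrite subr_gt0 expr_lt1 // ltW.
(* The second bound ensures s (1 - y0^2) >= 2, which makes [p.[y0]] negative below. *)
pose s := maxn k.+2 (Num.truncn (2 / (1 - y0 ^+ 2))).+1.
have sk : (k.+1 < s)%N by rewrite leq_max leqnn.
have s2 : 2 <= s%:R * (1 - y0 ^+ 2).
  rewrite -ler_pdivrMr //; apply: ltW; apply: lt_le_trans (truncnS_gt _) _.
  by rewrite ler_nat leq_max leqnn orbT.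
have s1 : 2 <= s%:R :> R by rewrite ler_nat; lia.
(* Minus the quadratic factor: it is negative at [y0] and equals s + 2 at 1, so it has a root in
   between. *)
pose p : {poly R} := - ((2 * s%:R * (s%:R + 1))%:P - (2 * (s%:R + 1)) *: 'X
   - (s%:R * (2 * s%:R + 1)) *: 'X^2).
have pE y : p.[y] = - (2 * s%:R * (s%:R + 1) - 2 * (s%:R + 1) * y - s%:R * (2 * s%:R + 1) * y ^+ 2).
  by rewrite /p !hornerE.
have p0 : p.[y0] < 0.
  rewrite pE oppr_lt0.
  have -> : 2 * s%:R * (s%:R + 1) - 2 * (s%:R + 1) * y0 - s%:R * (2 * s%:R + 1) * y0 ^+ 2 =
    2 * s%:R * (s%:R * (1 - y0 ^+ 2)) + 2 * s%:R * (1 - y0) - 2 * y0 - s%:R * y0 ^+ 2 by ring.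
  have h1 : 2 * s%:R * 2 <= 2 * s%:R * (s%:R * (1 - y0 ^+ 2)).
    by rewrite ler_wpM2l // mulr_ge0.
  have h2 : 0 <= 2 * s%:R * (1 - y0) by rewrite mulr_ge0 ?mulr_ge0 ?subr_ge0 ?(ltW y01).
  have h3 : s%:R * y0 ^+ 2 <= s%:R * 1.
    by rewrite ler_wpM2l // expr_le1 // ltW.
  lra.
have p1 : 0 < p.[1] by rewrite pE; nra.
have [y /andP[y0y yy1] ry] : exists2 y, y0 <= y <= 1 & root p y.
  by apply: poly_ivt; rewrite ?ltW // p0 p1.
move/rootP: ry => ry.
exists s, y; split=> //.
  rewrite !lt_neqAle y0y yy1 !andbT; apply/andP; split; apply/eqP => e.
    by move: p0; rewrite e ry ltxx.
  by move: p1; rewrite -e ry ltxx.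
have -> : moment_cubic s.+1%:R (s.*2)%:R (s.+1.*2)%:R s%:R y = - (s%:R * (1 - y) * p.[y]).
  rewrite /moment_cubic pE -!muln2 !natrM -!natr1; ring.
by rewrite ry mulr0 oppr0.
Qed.

Theorem theorem6p1 (R : realType) :
  (forall (n1 m1 n2 m2 : nat),
    (0 < n1)%N -> (0 < m1)%N -> (0 < n2)%N -> (0 < m2)%N ->
    (n1, m1) <> (n2, m2) ->
    forall (u1 : 'I_n1) (u2 : 'I_n2) (eps : R),
    0 < eps < 1 ->
    forall (dsp : measure_display) (Omega : measurableType dsp)
      (P : probability Omega R)
      (N1 : nvm P (complete_bipartite n1 m1) eps)
      (N2 : nvm P (complete_bipartite n2 m2) eps),
    [/\ (n1 = 1%N /\ n2 = 1%N ->
          ~ nvm_distinguishable N1 (inl u1) N2 (inl u2)),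
        ((n1 = n2 /\ (1 < n1)%N) \/ m1 = m2 ->
          distinguishable_by N1 (inl u1) N2 (inl u2) (@repetition R 2))
      & ((~ exists p : {poly int},
             size p = 4%N /\ root (map_poly intr p) ((1 - eps) ^+ 2)) ->
         (1 < maxn n1 n2)%N ->
          distinguishable_by N1 (inl u1) N2 (inl u2) (@repetition R 2))])
  /\
  (forall (k : nat) (eps' : R), 0 < eps' < 1 ->
    exists (eps : R) (n1 n2 m1 m2 : nat),
      [/\ 0 < eps < eps',
          [/\ (k < n1)%N, (k < n2)%N & n1 <> n2],
          [/\ (k < m1)%N, (k < m2)%N & m1 <> m2]
        & forall (u1 : 'I_n1) (u2 : 'I_n2)
            (dsp : measure_display) (Omega : measurableType dsp)
            (P : probability Omega R)
            (N1 : nvm P (complete_bipartite n1 m1) eps)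
            (N2 : nvm P (complete_bipartite n2 m2) eps),
          nvm_distinguishable N1 (inl u1) N2 (inl u2) /\
          (forall d : nat, p_ N1 (inl u1) d = p_ N2 (inl u2) d)]).
Proof.
split=> [n1 m1 n2 m2 n1_gt0 m1_gt0 n2_gt0 m2_gt0 nm u1 u2 eps eps01 dsp Omega P N1 N2|k eps' /andP[e'0 e'1]].
  split=> [[n1E n2E]|nmE|no_root n_gt1].
  - by subst n1 n2; exact: star_not_distinguishable.
  - apply: repetition_distinguishes => //; apply: moment_cubic_neq0 => //.
    exact: retention_bounds.
  - apply: repetition_distinguishes => //; apply/eqP => cub; apply: no_root.
    exact: (moment_cubic_root n1_gt0 m1_gt0 n2_gt0 m2_gt0 nm n_gt1 cub).
have sizes s : (k.+1 < s)%N ->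
    [/\ [/\ (k < s.+1)%N, (k < s.+1.*2)%N & s.+1 <> s.+1.*2],
        [/\ (k < s.*2)%N, (k < s)%N & s.*2 <> s]
      & [/\ (1 < s.+1)%N, (1 < s.*2)%N, (1 < s.+1.*2)%N & (1 < s)%N]].
  by move=> {eps' e'0 e'1} sk; split; split; lia.
have y0 : 0 < (1 - eps') ^+ 2 < 1 by apply: retention_bounds; rewrite e'0 e'1.
have [s [y [sk /andP[yy0 yy1] cub]]] := moment_cubic_near1 k y0.
have y_gt0 : 0 < y by apply: lt_trans yy0; case/andP: y0.
(* This noise makes [(1 - eps) ^+ 2] equal to the root [y]; it is below [eps'] because [y] exceeds
   [(1 - eps') ^+ 2]. *)
pose eps := 1 - Num.sqrt y.
have yE : (1 - eps) ^+ 2 = y by rewrite /eps opprB addrC subrK sqr_sqrtr // ltW.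
have sy1 : Num.sqrt y < 1 by rewrite -[ltRHS]sqrtr1 ltr_sqrt.
have sy0 : 0 < Num.sqrt y by rewrite sqrtr_gt0.
have eps01 : 0 < eps < 1 by rewrite /eps subr_gt0 sy1 gtrBl sy0.
exists eps, s.+1, (s.+1).*2, s.*2, s; split.
- rewrite /eps subr_gt0 sy1 /= ltrBlDr -ltrBlDl.
  rewrite -(@ltr_sqr _ (1 - eps') (Num.sqrt y)) ?nnegrE ?subr_ge0 ?ltW //.
  by rewrite sqr_sqrtr // ltW.
- by case: (sizes _ sk).
- by case: (sizes _ sk).
move=> u1 u2 dsp Omega P N1 N2.
have [_ _ [n1_gt1 m1_gt1 n2_gt1 m2_gt1]] := sizes _ sk.
have [[_ _ n12] _ _] := sizes _ sk.
have pE : second_moment s.+1 s.*2 eps = second_moment (s.+1).*2 s eps.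
  by apply/second_moment_eq => //; rewrite ?yE // ltnW.
split=> [|d].
  exact: lags_distinguish.
by rewrite !p_E ?pE // ltnW.
Qed.
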